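(* Let $\mathcal{A}$ be a finitely generated commutative unital $\mathbb{R}$-algebra, $\mathcal{S}$ an Archimedean semiring of $\mathcal{A}$, and $J$ an unbounded closed subset of $\mathbb{R}$. Let $L$ be a linear functional on $\mathcal{A}[z]$. If $L(a)\ge0$ for all $a\in\mathcal{S}\otimes\mathrm{Pos}(J)$, then $L$ is a $(\mathrm{char}(\mathcal{A},\mathcal{S})\times J)$-moment functional.
   Context: Let $\mathcal{A}$ be a commutative unital $\mathbb{R}$-algebra with unit $1$. A semiring of $\mathcal{A}$ is a subset $\mathcal{S}$ containing $1$ that is closed under addition, under multiplication by real scalars $\lambda\ge0$, and under multiplication. It is Archimedean if for every $a\in\mathcal{A}$ there is $\lambda\in(0,\infty)$ with $\lambda1-a\in\mathcal{S}$ and $\lambda1+a\in\mathcal{S}$. $\mathrm{char}(\mathcal{A},\mathcal{S})$ is the set of unital algebra homomorphisms $\varphi:\mathcal{A}\to\mathbb{R}$ with $\varphi(b)\ge0$ for all $b\in\mathcal{S}$, with the topology of pointwise convergence on $\mathcal{A}$. $\mathcal{A}[z]$ is the algebra of polynomials in one variable $z$ with coefficients in $\mathcal{A}$; for $a=\sum_ia_iz^i$ and $\eta\in\mathbb{R}$, $a(\eta)=\sum_i\eta^ia_i\in\mathcal{A}$. $\mathrm{Pos}(J):=\{p\in\mathbb{R}[z] : p(t)\ge0 \text{ for all } t\in J\}$, and $\mathcal{S}\otimes\mathrm{Pos}(J)\subseteq\mathcal{A}[z]$ is the convex cone of finite sums of elements $bp$ with $b\in\mathcal{S}$, $p\in\mathrm{Pos}(J)$.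 A pair $(\varphi,\eta)\in\mathrm{char}(\mathcal{A},\mathcal{S})\times J$ is identified with the character $a\mapsto\varphi(a(\eta))$ of $\mathcal{A}[z]$. That $L$ is a $(\mathrm{char}(\mathcal{A},\mathcal{S})\times J)$-moment functional means: there is a Radon measure $\mu$ supported on $\mathrm{char}(\mathcal{A},\mathcal{S})\times J$ with $L(a)=\int\varphi(a(\eta))\,d\mu(\varphi,\eta)$ for all $a\in\mathcal{A}[z]$. *)

(* Defs.v *)
From HB Require Import structures.
From mathcomp Require Import all_boot all_order all_algebra.
From mathcomp Require Import all_classical all_reals all_analysis.

Set Implicit Arguments.
Unset Strict Implicit.
Unset Printing Implicit Defensive.

Import Order.TTheory GRing.Theory Num.Theory.
Import numFieldNormedType.Exports.

Local Open Scope classical_set_scope.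
Local Open Scope ring_scope.

Definition finitely_generated (R : realType) (A : comAlgType R) : Prop :=
  exists s : seq A, forall B : {pred A},
    GRing.subalg_closed B -> {subset s <= B} -> forall a, a \in B.

Definition is_semiring (R : realType) (A : comAlgType R) (S : set A) : Prop :=
  [/\ S 1,
      forall a b, S a -> S b -> S (a + b),
      forall (c : R) a, 0 <= c -> S a -> S (c *: a) &
      forall a b, S a -> S b -> S (a * b)].

Definition archimedean (R : realType) (A : comAlgType R) (S : set A) : Prop :=
  forall a, exists2 c : R, 0 < c & S (c%:A - a) /\ S (c%:A + a).

Definition Pos (R : realType) (J : set R) : set {poly R} :=
  [set p | forall t, J t -> 0 <= p.[t]].

(* [map_poly (in_alg A)] is the embedding of R[z] into A[z]. *)
Definition tensor_Pos (R : realType) (A : comAlgType R) (S : set A)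
    (J : set R) : set {poly A} :=
  [set f | exists n (b : 'I_n -> A) (p : 'I_n -> {poly R}),
     (forall i, S (b i) /\ Pos J (p i)) /\
     f = \sum_(i < n) b i *: map_poly (in_alg A) (p i)].

(* {poly A} is an lmodType over A but not over R in the library: scaling a
   polynomial by a real c is scaling it by c%:A. *)
Definition real_linear (R : realType) (A : comAlgType R)
    (L : {poly A} -> R) : Prop :=
  forall (c : R) (f g : {poly A}), L (c%:A *: f + g) = c * L f + L g.

(* char(A, S), as a subset of the space of all functions A -> R with the
   topology of pointwise convergence; [scalar phi] is R-linearity. *)
Definition char (R : realType) (A : comAlgType R) (S : set A) :
    set {ptws A -> R} :=
  [set phi | [/\ scalar (phi : A -> R),
                 monoid_morphism (phi : A -> R) &
                 forall b, S b -> 0 <= phi b]].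

Definition borel (T : ptopologicalType) := g_sigma_algebraType (@open T).

Definition radon (R : realType) (T : ptopologicalType)
    (mu : {measure set (borel T) -> \bar R}) : Prop :=
  (forall K : set T, compact K -> measurable (K : set (borel T)) ->
     (mu K < +oo)%E) /\
  (forall B : set (borel T), measurable B ->
     mu B = ereal_sup [set mu K | K in
       [set K : set T | [/\ compact K, measurable (K : set (borel T)) &
                            K `<=` B]]]).

(* R^A x R, in which char S `*` J is a closed subset; the instances only make
   the product available as a pointed topological space. *)
Definition ambient (R : realType) (A : comAlgType R) : Type :=
  ({ptws A -> R} * R)%type.

HB.instance Definition _ (R : realType) (A : comAlgType R) :=
  Topological.copy (ambient A) ({ptws A -> R} * R)%type.
HB.instance Definition _ (R : realType) (A : comAlgType R) :=
  Pointed.copy (ambient A) ({ptws A -> R} * R)%type.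

(* The measure lives on the Borel sets of the Hausdorff space [ambient A] and
   is carried by its closed subset char S `*` J.  Such measures correspond to
   the Radon measures on the space char S `*` J itself, which may be empty,
   whereas a measurableType is always inhabited.
   [f.[eta%:A]] is the element f(eta) of A. *)
Definition moment_functional (R : realType) (A : comAlgType R) (S : set A)
    (J : set R) (L : {poly A} -> R) : Prop :=
  exists mu : {measure set (borel (ambient A)) -> \bar R},
    [/\ radon mu,
        mu (~` (char S `*` J)) = 0%E &
        forall f : {poly A},
          let ev (x : borel (ambient A)) := (x.1 f.[x.2%:A])%:E in
          mu.-integrable (char S `*` J) ev /\
          (L f)%:E = (\int[mu]_(x in char S `*` J) ev x)%E].

(* Main.v *)
Require Import Defs.
From mathcomp Require Import all_boot all_order all_algebra.
From mathcomp Require Import all_classical all_reals all_analysis.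
From mathcomp Require Import measurable_realfun ring lra.

Set Implicit Arguments.
Unset Strict Implicit.
Unset Printing Implicit Defensive.

Import Order.TTheory GRing.Theory Num.Theory.
Import numFieldNormedType.Exports.

Local Open Scope classical_set_scope.
Local Open Scope ring_scope.

(** Put [X = char(A, S) x J].  The proof has two halves.

    Positivity.  First, [L f >= 0] whenever [f >= 0] on [X] ([functional_ge0]).
    An element of [A] that is positive on all characters lies in [S]
    ([archimedean_positivstellensatz]).  After rescaling, [A] has generators
    [y] with [y] and [1 - y] in [S], so the products of Bernstein weights
    [C(n, j) y ^ j (1 - y) ^ (n - j)] form a partition of unity [b_i] inside [S],
    concentrated for large [n] near grid points.  Replacing every coefficient
    [a] of [f] by [\sum_i v_i(a) b_i], where [v_i] is a character close to the
    [i]-th grid point, changes it by an element that is uniformly small on the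
    characters ([finite_rank_approximation]), hence changes [L f] little.  The
    new polynomial is [\sum_i b_i f(v_i, z)], a sum of products of elements of [S]
    and of [Pos J].

    Representation.  By the extension theorem of M. Riesz
    ([positive_extension]), [L] extends to a positive functional [F] on all
    functions on [X] bounded by a polynomial, in particular to indicator
    functions; this gives a finitely additive mass on all subsets of [X].
    Countable additivity is obtained from Lebesgue measure.  Countably many
    bits, comparing the generators and [z] with the rationals, cut [X] into a
    binary tree of cells.  Nested half-open intervals of the line are assigned
    to the cells, with lengths equal to the masses.  A point [t] of the root
    interval selects a branch of the tree, and the cells on it shrink to a point
    of [X] ([limit_point]), except when [z] is unbounded on all of them, which
    happens with probability zero because [z ^ 2] has a finite mean.  A bounded
    function whose oscillation on the cells tends to zero with the depth has the
    same integral along the line as under [F] ([tree_integral]); truncating in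
    [z] and passing to the limit by monotone and dominated convergence extends
    this to all polynomials ([limit_point_representation]).  The measure is the
    image of Lebesgue measure under [limit_point].  It is Radon because off the
    countably many end points of the intervals that map is continuous, so that
    it sends compact sets to compact sets ([radon_image]). *)

(** * Zorn's lemma above a set *)

(** The union of the empty chain is the empty set, for which [P] may fail;
    adjoining [M0] to all sets turns that union into [M0]. *)
Lemma zorn_above (T : Type) (P : set (set T)) (M0 : set T) :
  P M0 ->
  (forall F : set (set T), F !=set0 -> F `<=` P -> total_on F subset ->
     P (\bigcup_(X in F) X)) ->
  exists M, [/\ M0 `<=` M, P M & forall N, M `<=` N -> P N -> N = M].
Proof.
move=> PM0 Pchain.
have [|M [PM maxM]] := @Zorn_bigcup T [set N | P (N `|` M0)].
  move=> F FP Ftot /=.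
  have [->|/set0P[X0 FX0]] := eqVneq F set0.
    by rewrite bigcup_set0 set0U.
  rewrite (_ : _ `|` _ = \bigcup_(X in [set Y `|` M0 | Y in F]) X).
    apply: Pchain.
    - by exists (X0 `|` M0), X0.
    - by move=> _ [Y FY <-]; exact: FP.
    - move=> _ _ [Y FY <-] [Z FZ <-].
      by have [YZ|ZY] := Ftot _ _ FY FZ; [left|right]; exact: setSU.
  rewrite bigcup_image; apply/seteqP; split=> [x [[Y FY Yx]|M0x]|x [Y FY [Yx|M0x]]].
  - by exists Y => //; left.
  - by exists X0 => //; right.
  - by left; exists Y.
  - by right.
have M0M : M0 `<=` M.
  apply: contrapT => M0M; apply: (maxM (M `|` M0)) => /=.
  - by split=> [x Mx|MM]; [left|apply: M0M => x M0x; apply: MM; right].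
  - by rewrite -setUA setUid.
exists M; split => //; first by move: PM => /=; rewrite setUidl.
move=> N MN PN; apply: contrapT => NM; apply: (maxM N) => /=.
- by split=> // NsM; apply: NM; apply/seteqP.
- by rewrite setUidl//; apply: subset_trans MN.
Qed.

(** * Characters and the Archimedean Positivstellensatz *)

Section CharacterAlgebra.
Variables (R : realType) (A : comAlgType R) (S : set A).
Variables (phi : A -> R) (cphi : char S phi).

Lemma char0 : phi 0 = 0.
Proof.
case: cphi => lin _ _; have := lin (-1) 0 0.
by rewrite /= scaler0 addr0 mulN1r addNr.
Qed.

Lemma charD a b : phi (a + b) = phi a + phi b.
Proof. by case: cphi => lin _ _; rewrite -[a]scale1r lin/= mul1r scale1r. Qed.

Lemma charZ (c : R) a : phi (c *: a) = c * phi a.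
Proof. by case: cphi => lin _ _; rewrite -[_ *: _]addr0 lin/= char0 addr0. Qed.

Lemma charN a : phi (- a) = - phi a.
Proof. by rewrite -scaleN1r charZ mulN1r. Qed.

Lemma charB a b : phi (a - b) = phi a - phi b.
Proof. by rewrite charD charN. Qed.

Lemma char1 : phi 1 = 1.
Proof. by case: cphi => _ [-> _] _. Qed.

Lemma charC (c : R) : phi c%:A = c.
Proof. by rewrite charZ char1 mulr1. Qed.

Lemma charM a b : phi (a * b) = phi a * phi b.
Proof. by case: cphi => _ [_ ->] _. Qed.

Lemma charX a n : phi (a ^+ n) = phi a ^+ n.
Proof. by elim: n => [|n IH]; rewrite ?expr0 ?char1// !exprS charM IH. Qed.

Lemma char_sum I (s : seq I) (P : pred I) (F : I -> A) :
  phi (\sum_(i <- s | P i) F i) = \sum_(i <- s | P i) phi (F i).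
Proof. by apply: big_morph; [exact: charD|exact: char0]. Qed.

Lemma char_prod I (s : seq I) (P : pred I) (F : I -> A) :
  phi (\prod_(i <- s | P i) F i) = \prod_(i <- s | P i) phi (F i).
Proof. by apply: big_morph; [exact: charM|exact: char1]. Qed.

Lemma char_ge0 b : S b -> 0 <= phi b.
Proof. by case: cphi => _ _; apply. Qed.
End CharacterAlgebra.

Section SemiringCone.
Variables (R : realType) (A : comAlgType R) (S : set A).
Hypotheses (semiringS : is_semiring S) (archS : archimedean S).

Lemma semiring1 : S 1. Proof. by case: semiringS. Qed.
Lemma semiringD a b : S a -> S b -> S (a + b).
Proof. by case: semiringS => _ + _ _; apply. Qed.
Lemma semiringZ (c : R) a : 0 <= c -> S a -> S (c *: a).
Proof. by case: semiringS => _ _ + _; apply. Qed.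
Lemma semiringM a b : S a -> S b -> S (a * b).
Proof. by case: semiringS => _ _ _; apply. Qed.
Lemma semiringC (c : R) : 0 <= c -> S c%:A.
Proof. by move=> c0; apply: semiringZ => //; exact: semiring1. Qed.
Lemma semiring0 : S 0.
Proof. by rewrite -(scale0r 1); exact: semiringC. Qed.

(** From [a t = 1 + s] one gets [a + c - k^-1 \in S] out of [a + c \in S], where
    [k - t \in S]; finitely many such steps bring the constant below zero. *)
Lemma semiring_of_mul_ge1 a t s : S t -> S s -> a * t = 1 + s -> S a.
Proof.
move=> St Ss ats.
have [k k0 [Skt _]] := archS t.
have [c c0 [_ Sca]] := archS a.
have kA : k *: (k^-1%:A) = 1 :> A by rewrite scalerA mulfV ?gt_eqF// scale1r.
have step n : S a \/ S ((c - n%:R / k)%:A + a).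
  elim: n => [|n [Sa|Sn]]; first by right; rewrite mul0r subr0.
    by left.
  move: Sn; rewrite -natr1; move Ed : (c - n%:R / k) => d Sn.
  have [d0|d0] := leP d 0.
    left; rewrite (_ : a = (- d)%:A + (d%:A + a)).
      by apply: semiringD => //; apply: semiringC; rewrite oppr_ge0.
    by rewrite addrA -scalerDl addNr scale0r add0r.
  right.
  have -> : (c - (n%:R + 1) / k)%:A + a =
      k^-1 *: ((k%:A - t) * (d%:A + a) + s + d *: t).
    have -> : s = a * t - 1 by rewrite ats addrC addKr.
    have -> : (k%:A - t) * (d%:A + a) + (a * t - 1) + d *: t =
        (k * d - 1)%:A + k *: a.
      have kd : (k * d)%:A = k%:A * d%:A :> A by exact: (rmorphM (in_alg A)).
      by rewrite -[d *: t]mulr_algl -[k *: a]mulr_algl scalerBl scale1r kd; ring.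
    rewrite scalerDr scalerA scalerA mulVf ?gt_eqF// scale1r; congr (_ *: _ + _).
    by rewrite -Ed; field; rewrite gt_eqF.
  apply: semiringZ; first by rewrite invr_ge0 ltW.
  apply: semiringD; last by apply: semiringZ => //; exact: ltW.
  by apply: semiringD => //; exact: semiringM.
have [Sa|Sn] := step (Num.bound (c * k)) => //.
rewrite (_ : a = ((Num.bound (c * k))%:R / k - c)%:A +
    ((c - (Num.bound (c * k))%:R / k)%:A + a)).
  apply: semiringD => //; apply: semiringC.
  rewrite subr_ge0 ler_pdivlMr// ltW//.
  by rewrite archi_boundP// mulr_ge0 ?ltW.
by rewrite addrA -scalerDl -opprB addNr scale0r add0r.
Qed.

(** Sets of nonnegative elements for a preorder on [A] compatible with [S].  The
    maximal ones are the half spaces [0 <= phi] of the characters [phi]. *)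
Definition proper_module (M : set A) : Prop :=
  [/\ S `<=` M, forall a b, M a -> M b -> M (a + b),
      forall s a, S s -> M a -> M (s * a) & ~ M (- 1)].

Section MaximalModule.
Variables (M : set A) (pM : proper_module M).
Hypothesis maxM : forall N, M `<=` N -> proper_module N -> N = M.

Let SM : S `<=` M. Proof. by case: pM. Qed.
Let MD a b : M a -> M b -> M (a + b). Proof. by case: pM => _ + _ _; apply. Qed.
Let MM s a : S s -> M a -> M (s * a). Proof. by case: pM => _ _ + _; apply. Qed.
Let MN1 : ~ M (- 1). Proof. by case: pM. Qed.
Let MZ (c : R) a : 0 <= c -> M a -> M (c *: a).
Proof. by move=> c0 Ma; rewrite -mulr_algl; apply: MM => //; exact: semiringC. Qed.

Let MC (c : R) : M c%:A -> 0 <= c.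
Proof.
move=> Mc; rewrite leNgt; apply/negP => c0; apply: MN1.
have := MZ (_ : 0 <= - c^-1) Mc; rewrite scalerA mulNr mulVf ?lt_eqF//.
by rewrite scaleN1r; apply; rewrite oppr_ge0 invr_le0 ltW.
Qed.

Let notM a : ~ M a -> exists m t, [/\ M m, S t & - 1 = m + a * t].
Proof.
move=> Ma; apply: contrapT => nex; apply: Ma.
pose N := [set x | exists m t, [/\ M m, S t & x = m + a * t]].
suff <- : N = M.
  by exists 0, 1; split; rewrite ?add0r ?mulr1//; [exact/SM/semiring0|exact: semiring1].
apply: maxM => [x Mx|]; first by exists x, 0; split; rewrite ?mulr0 ?addr0//; exact: semiring0.
split.
- by move=> x Sx; exists x, 0; split; rewrite ?mulr0 ?addr0//; [exact: SM|exact: semiring0].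
- move=> _ _ [m [t [Mm St ->]]] [m' [t' [Mm' St' ->]]].
  exists (m + m'), (t + t'); split; [exact: MD|exact: semiringD|ring].
- move=> s _ Ss [m [t [Mm St ->]]].
  exists (s * m), (s * t); split; [exact: MM|exact: semiringM|ring].
- by move=> [m [t [Mm St e]]]; apply: nex; exists m, t.
Qed.

(** If both [-1 = m + a t] and [-1 = m' - a t'], then eliminating [a] puts
    [- t] in [M], and then the first equation puts [-1] in [M]. *)
Let M_total a : M a \/ M (- a).
Proof.
apply: contrapT => /not_orP[/notM[m [t [Mm St e]]] /notM[m' [t' [Mm' St' e']]]].
have MNt : M (- t).
  have -> : - t = t' + (t' * m + t * m').
    have e1 : m' = a * t' - 1 by rewrite e'; ring.
    have e2 : m = - 1 - a * t by rewrite e; ring.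
    by rewrite e1 e2; ring.
  by apply: MD; [exact: SM|apply: MD; exact: MM].
have [k k0 [_ Ska]] := archS a.
apply: MN1; rewrite e.
have -> : m + a * t = m + (k%:A + a) * t + k *: - t.
  by rewrite -[k *: - t]mulr_algl; ring.
apply: MD; last by apply: MZ => //; exact: ltW.
by apply: MD => //; apply/SM/semiringM.
Qed.

Let MDC b (x y : R) : x <= y -> M (b + x%:A) -> M (b + y%:A).
Proof.
move=> xy Mb; rewrite -(subrK x y) scalerDl [in X in _ + X]addrC addrA.
by apply: MD => //; apply/SM/semiringC => //; rewrite subr_ge0.
Qed.

(** [lower b r] says that [b] is, up to infinitesimals, at least the constant
    [r] for the total preorder defined by [M]; [at_value] is then the graph of
    a character. *)
Let lower b (r : R) := forall e, 0 < e -> M (b + (e - r)%:A).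
Let at_value b r := lower b r /\ lower (- b) (- r).

Let lower_le b r r' : lower b r -> lower (- b) (- r') -> r <= r'.
Proof.
move=> br br'; apply/ler_addgt0Pl => e e0; rewrite -subr_ge0; apply: MC.
have e20 : 0 < e / 2 by rewrite divr_gt0.
have := MD (br _ e20) (br' _ e20); congr M.
by rewrite addrACA subrr add0r -scalerDl; congr (_ *: _); field.
Qed.

Let at_value_uniq b r r' : at_value b r -> at_value b r' -> r = r'.
Proof.
by move=> [b1 b2] [b1' b2']; apply/le_anti; rewrite !(lower_le b1, lower_le b1').
Qed.

Let at_value_ex b : exists r, at_value b r.
Proof.
have [k k0 [Skb Skb']] := archS b.
pose E := [set x : R | M (b + (- x)%:A)].
have E0 : E !=set0.
  by exists (- k); rewrite /E/= opprK addrC; exact: SM.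
have Eub : ubound E k.
  move=> x Ex; rewrite -subr_ge0; apply: MC.
  have := MD (SM Skb) Ex; congr M.
  by rewrite addrA subrK -scalerDl.
have supE : has_sup E by split => //; exists k.
exists (sup E); split=> e e0.
  have [x Ex ltx] := sup_adherent e0 supE.
  by apply: MDC Ex; rewrite -opprB lerN2 ltW.
have [Mb|] := M_total (b + (- (sup E + e))%:A).
  have : E (sup E + e) by [].
  move/(ub_le_sup supE.2); rewrite leNgt => /negP; case.
  by rewrite ltrDl.
by congr M; rewrite opprD -scaleNr; congr (_ + _ *: _); ring.
Qed.

Let lowerD b r b' r' : lower b r -> lower b' r' -> lower (b + b') (r + r').
Proof.
move=> br br' e e0; have e20 : 0 < e / 2 by rewrite divr_gt0.
have := MD (br _ e20) (br' _ e20); congr M.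
by rewrite addrACA -scalerDl; congr (_ + _ *: _); field.
Qed.

Let at_valueN b r : at_value b r -> at_value (- b) (- r).
Proof. by move=> [? ?]; split => //; rewrite !opprK. Qed.

Let at_valueD b r b' r' :
  at_value b r -> at_value b' r' -> at_value (b + b') (r + r').
Proof. by move=> [? ?] [? ?]; split; rewrite ?opprD; apply: lowerD. Qed.

Let lowerZ (c : R) b r : 0 < c -> lower b r -> lower (c *: b) (c * r).
Proof.
move=> c0 br e e0; have /br/(MZ (ltW c0)) : 0 < e / c by rewrite divr_gt0.
by congr M; rewrite scalerDr scalerA; congr (_ + _ *: _); field; rewrite gt_eqF.
Qed.

Let at_valueC (c : R) : at_value c%:A c.
Proof.
split=> e /ltW e0.
  by rewrite -scalerDl addrC subrK; apply/SM/semiringC.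
by rewrite -scaleNr -scalerDl opprK addrC addrK; apply/SM/semiringC.
Qed.

Let at_valueZ (c : R) b r : at_value b r -> at_value (c *: b) (c * r).
Proof.
have pos d : 0 < d -> at_value b r -> at_value (d *: b) (d * r).
  by move=> d0 [b1 b2]; split; rewrite -?scalerN -?mulrN; exact: lowerZ.
move=> br; have [c0|c0|->] := ltgtP c 0; last 2 first.
- exact: pos.
- by rewrite !(scale0r, mul0r); have := at_valueC 0; rewrite scale0r.
have := at_valueN (pos (- c) _ br); rewrite oppr_gt0 => /(_ c0).
by rewrite scaleNr mulNr !opprK.
Qed.

Let lower_ge0 b r : S b -> at_value b r -> 0 <= r.
Proof.
move=> Sb [b1 b2]; apply: (@lower_le b) => // e e0.
by rewrite subr0; apply: MD; apply: SM => //; apply: semiringC; exact: ltW.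
Qed.

(** Multiply [c - (q - d)] by [b], and compare [(q - d) b] with its value
    [(q - d) r]. *)
Let lowerM b r c q : S b -> at_value b r -> lower c q -> lower (b * c) (r * q).
Proof.
move=> Sb br cq e e0; have r0 := lower_ge0 Sb br.
(* [d] is such that [d r + e / 2 <= e]. *)
have d0 : 0 < e / 2 / (r + 1) by rewrite !divr_gt0// ltr_wpDl.
have := cq _ d0; move Ed : (e / 2 / (r + 1)) => d.
move=> /(MM Sb); rewrite mulrDr mulr_algr => M1.
have e20 : 0 < e / 2 by rewrite divr_gt0.
have [/(_ _ e20) M2 _] := at_valueZ (q - d) br.
have := MD M1 M2; rewrite addrA -[_ + _ + (q - d) *: b]addrA -scalerDl.
rewrite (_ : d - q + (q - d) = 0) ?scale0r ?addr0; last ring.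
apply: MDC; rewrite -subr_ge0 (_ : _ - _ = e / 2 - d * r); last by field.
have r10 : r + 1 != 0 by rewrite gt_eqF// ltr_wpDl.
rewrite (_ : e / 2 - d * r = d); last by rewrite -Ed; field.
by rewrite -Ed !divr_ge0 ?ltW// ltr_wpDl.
Qed.

(** Every [b] is the difference of [k + b] and [k], both in [S]. *)
Let at_valueM b r c q : at_value b r -> at_value c q -> at_value (b * c) (r * q).
Proof.
have pos b' r' : S b' -> at_value b' r' -> at_value c q -> at_value (b' * c) (r' * q).
  move=> Sb br [c1 c2]; split; first exact: lowerM.
  by rewrite -!mulrN; exact: lowerM.
move=> br cq; have [k k0 [_ Skb]] := archS b.
have := at_valueD (pos _ _ Skb (at_valueD (at_valueC k) br) cq)
  (at_valueZ (- k) cq).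
congr at_value; last by ring.
by rewrite mulrDl mulr_algl scaleNr addrAC subrr add0r.
Qed.

(** [at_value] is the graph of a function by [at_value_ex] and [at_value_uniq],
    and it is compatible with the operations of [A]. *)
Lemma char_of_maximal_module :
  exists phi : A -> R, char S phi /\ forall a, M a -> 0 <= phi a.
Proof.
have [phi phiP] := choice at_value_ex.
have phiE a r : at_value a r -> phi a = r by exact: at_value_uniq.
exists phi; split; first split.
- by move=> c a b; apply: phiE; apply: at_valueD => //; exact: at_valueZ.
- split=> [|a b]; last by apply: phiE; exact: at_valueM.
  by apply: phiE; have := at_valueC 1; rewrite scale1r.
- by move=> b Sb; exact: lower_ge0 (phiP b).
- move=> a Ma; have [_ a2] := phiP a.
  apply: (@lower_le a) => // e e0; rewrite subr0; apply: MD => //.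
  by apply/SM/semiringC; exact: ltW.
Qed.
End MaximalModule.

(** If [a] is not in [S], then [-1] is not in the module [S - a S], by
    [semiring_of_mul_ge1], and a maximal proper module above it is the half
    space of a character that is nonpositive at [a]. *)
Theorem archimedean_positivstellensatz a :
  (forall phi, char S phi -> 0 < phi a) -> S a.
Proof.
move=> apos; apply: contrapT => Sa.
pose M0 := [set x | exists s t, [/\ S s, S t & x = s - a * t]].
have pM0 : proper_module M0.
  split.
  - by move=> s Ss; exists s, 0; rewrite mulr0 subr0; split => //; exact: semiring0.
  - move=> _ _ [s [t [Ss St ->]]] [s' [t' [Ss' St' ->]]].
    exists (s + s'), (t + t'); split; [exact: semiringD|exact: semiringD|ring].
  - move=> r _ Sr [s [t [Ss St ->]]].
    exists (r * s), (r * t); split; [exact: semiringM|exact: semiringM|ring].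
  - move=> [s [t [Ss St e]]]; apply/Sa/(semiring_of_mul_ge1 St Ss).
    by rewrite -[s](subrK (a * t)) -e; ring.
have [|M [M0M pM maxM]] := zorn_above pM0.
  move=> F [X0 FX0] FP Ftot; split.
  - by move=> x Sx; exists X0 => //; case: (FP _ FX0) => + _ _ _; apply.
  - move=> x y [X FX Xx] [Y FY Yy].
    have [XY|YX] := Ftot _ _ FX FY.
      by exists Y => //; case: (FP _ FY) => _ + _ _; apply => //; exact: XY.
    by exists X => //; case: (FP _ FX) => _ + _ _; apply => //; exact: YX.
  - by move=> s x Ss [X FX Xx]; exists X => //; case: (FP _ FX) => _ _ + _; apply.
  - by move=> [X FX]; case: (FP _ FX).
have [phi [charphi phiM]] := char_of_maximal_module pM maxM.
have : 0 <= phi (- a).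
  apply/phiM/M0M; exists 0, 1; split; [exact: semiring0|exact: semiring1|].
  by rewrite mulr1 sub0r.
have := apos _ charphi; rewrite (charN charphi) oppr_ge0 => + le.
by rewrite ltNge le.
Qed.
End SemiringCone.

(** * Bernstein weights *)

Section Bernstein.
Variable B : comNzRingType.

Definition bernstein n (x : B) j : B := x ^+ j * (1 - x) ^+ (n - j) *+ 'C(n, j).

Lemma sum_bernstein n x : \sum_(j < n.+1) bernstein n x j = 1.
Proof.
have := exprDn (1 - x) x n; rewrite subrK expr1n => ->.
by apply: eq_bigr => j _; rewrite mulrC.
Qed.

Lemma bernsteinS n x j : (j <= n)%N ->
  bernstein n.+1 x j.+1 = x * bernstein n x j + (1 - x) * bernstein n x j.+1.
Proof.
move=> jn; rewrite /bernstein binS mulrnDr addrC subSS -!mulrnAr; congr (_ + _).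
  by rewrite exprS !mulrnAr mulrA.
case: ltngtP jn => // [jn|->] _; last by rewrite bin_small// !mulr0n !mulr0.
rewrite !mulrnAr; congr (_ *+ _).
by rewrite (_ : n - j = (n - j.+1).+1)%N ?exprS; [ring|rewrite subnSK].
Qed.

(** Bernstein weights are the distribution of the number of successes in [n]
    trials: condition on the last trial. *)
Lemma sum_bernsteinS n x (g : nat -> B) :
  \sum_(j < n.+2) bernstein n.+1 x j * g j =
  x * (\sum_(j < n.+1) bernstein n x j * g j.+1) +
  (1 - x) * (\sum_(j < n.+1) bernstein n x j * g j).
Proof.
rewrite big_ord_recl /=.
have -> : \sum_(j < n.+1) bernstein n.+1 x (bump 0 j) * g (bump 0 j) =
   \sum_(j < n.+1) (x * (bernstein n x j * g j.+1) +
     (1 - x) * (bernstein n x j.+1 * g j.+1)).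
  apply: eq_bigr => j _; rewrite /bump/= add1n bernsteinS ?mulrDl ?mulrA//.
  by rewrite -ltnS ltn_ord.
rewrite big_split/= -!mulr_sumr addrCA; congr (_ + _).
rewrite [in RHS]big_ord_recl /= mulrDr; congr (_ + _).
  by rewrite /bernstein !bin0 !subn0 exprS; ring.
rewrite big_ord_recr /= {2}/bernstein bin_small// mulr0n mul0r addr0.
by rewrite mulr_sumr; apply: eq_bigr.
Qed.

Lemma bernstein_variance n (x c : B) :
  \sum_(j < n.+1) bernstein n x j * (j%:R - c) ^+ 2 =
  n%:R * (x * (1 - x)) + (n%:R * x - c) ^+ 2.
Proof.
elim: n c => [|n IH] c.
  by rewrite big_ord1 /bernstein /= bin0 !expr0 mulr0n mulr1n; ring.
rewrite (sum_bernsteinS n x (fun j => (j%:R - c) ^+ 2)) IH.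
have -> : \sum_(j < n.+1) bernstein n x j * (j.+1%:R - c) ^+ 2 =
          \sum_(j < n.+1) bernstein n x j * (j%:R - (c - 1)) ^+ 2.
  by apply: eq_bigr => j _; rewrite -natr1; congr (_ * _ ^+ 2); ring.
by rewrite IH -natr1; ring.
Qed.

(** The coordinates are independent under products of Bernstein weights. *)
Lemma sum_bernstein_prod d n (y : 'I_d -> B) :
  \sum_(al : {ffun 'I_d -> 'I_n.+1}) \prod_i bernstein n (y i) (al i) = 1.
Proof.
rewrite -(bigA_distr_bigA (fun i (j : 'I_n.+1) => bernstein n (y i) j)) /=.
by rewrite big1// => i _; exact: sum_bernstein.
Qed.

Lemma bernstein_prod_marginal d n (y : 'I_d -> B) i0 (g : nat -> B) :
  \sum_(al : {ffun 'I_d -> 'I_n.+1})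
     (\prod_i bernstein n (y i) (al i)) * g (al i0) =
  \sum_(j < n.+1) bernstein n (y i0) j * g j.
Proof.
pose F i (j : 'I_n.+1) := bernstein n (y i) j * (if i == i0 then g j else 1).
transitivity (\sum_(al : {ffun 'I_d -> 'I_n.+1}) \prod_i F i (al i)).
  apply: eq_bigr => al _; rewrite big_split/=; congr (_ * _).
  rewrite (bigD1 i0)//= eqxx big1 ?mulr1//.
  by move=> i ni; rewrite (negbTE ni).
rewrite -(bigA_distr_bigA F) /= (bigD1 i0)//= [X in _ * X]big1 ?mulr1 => [|i ni].
  by apply: eq_bigr => j _; rewrite /F eqxx.
rewrite -[RHS](sum_bernstein n (y i)).
by apply: eq_bigr => j _; rewrite /F (negbTE ni) mulr1.
Qed.
End Bernstein.

Section Characters.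
Variables (R : realType) (A : comAlgType R) (S : set A).
Hypotheses (semiringS : is_semiring S) (archS : archimedean S).
Hypothesis fgA : finitely_generated A.

Lemma char_bounded a : exists2 c : R, 0 < c & forall phi, char S phi -> `|phi a| <= c.
Proof.
have [c c0 [Sc1 Sc2]] := archS a; exists c => // phi cphi.
have := char_ge0 cphi Sc1; have := char_ge0 cphi Sc2.
by rewrite (charD cphi) (charB cphi) !(charC cphi) ler_norml; lra.
Qed.

(** Replace each generator [x] by [(c + x) / 2 c], where [c + x] and [c - x] lie
    in [S].  That the new generators span is stated as an induction principle,
    the form in which it is used. *)
Lemma unit_interval_generators : exists d (y : 'I_d -> A),
  (forall i, S (y i) /\ S (1 - y i)) /\
  forall Q : A -> Prop, (forall i, Q (y i)) -> Q 1 ->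
    (forall (c : R) a b, Q a -> Q b -> Q (c *: a + b)) ->
    (forall a b, Q a -> Q b -> Q (a * b)) -> forall a, Q a.
Proof.
have [s sP] := fgA.
have /choice[c cP] : forall a : A, exists c : R,
    [/\ 0 < c, S (c%:A - a) & S (c%:A + a)].
  by move=> a; have [c c0 [? ?]] := archS a; exists c.
pose x (i : 'I_(size s)) := s`_i; exists (size s).
exists (fun i => (c (x i) + c (x i))^-1 *: ((c (x i))%:A + x i)); split=> [i|Q Qy Q1 QZD QM].
  have [c0 S1 S2] := cP (x i); have cc0 : 0 < c (x i) + c (x i) by rewrite addr_gt0.
  split; first by apply: (semiringZ semiringS) => //; rewrite invr_ge0 ltW.
  rewrite (_ : 1 - _ = (c (x i) + c (x i))^-1 *: ((c (x i))%:A - x i)).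
    by apply: (semiringZ semiringS) => //; rewrite invr_ge0 ltW.
  rewrite -{1}[1](scalerK (lt0r_neq0 cc0)) -scalerBr; congr (_ *: _).
  by rewrite scalerDl opprD addrACA subrr add0r.
move=> a; apply/asboolP.
apply: (sP [pred a | `[< Q a >]]).
  split=> [|k u v|u v]; rewrite !inE.
  - by [].
  - exact: QZD.
  - exact: QM.
move=> _ /(nthP 0)[i si <-]; rewrite inE.
have := Qy (Ordinal si); rewrite /x /=; have [c0 _ _] := cP s`_i.
move=> Qi; have cc0 : c s`_i + c s`_i != 0 by rewrite gt_eqF// addr_gt0.
have Q0 : Q 0 by have := QZD (-1) _ _ Q1 Q1; rewrite scaleN1r addNr.
rewrite (_ : s`_i = (c s`_i + c s`_i) *:
    ((c s`_i + c s`_i)^-1 *: ((c s`_i)%:A + s`_i)) + ((- c s`_i) *: 1 + 0)).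
  by apply: (QZD) => //; exact: QZD.
by rewrite scalerA mulfV// scale1r scaleNr addr0 addrAC subrr add0r.
Qed.

Variables (d : nat) (y : 'I_d -> A).
Hypothesis Sy : forall i, S (y i) /\ S (1 - y i).
Hypothesis y_gen : forall Q : A -> Prop, (forall i, Q (y i)) -> Q 1 ->
    (forall (c : R) a b, Q a -> Q b -> Q (c *: a + b)) ->
    (forall a b, Q a -> Q b -> Q (a * b)) -> forall a, Q a.

(** The elements for which this holds form a subalgebra; for products it matters
    that characters are bounded at each element. *)
Lemma char_unif_continuous a e : 0 < e -> exists2 r : R, 0 < r &
  forall phi psi, char S phi -> char S psi ->
    (forall i, `|phi (y i) - psi (y i)| <= r) -> `|phi a - psi a| <= e.
Proof.
move: a e; apply: y_gen => [i e e0|e e0|c a b Ha Hb e e0|a b Ha Hb e e0].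
- by exists e => // phi psi _ _; apply.
- exists 1 => // phi psi [_ [-> _] _] [_ [-> _] _] _.
  by rewrite subrr normr0 ltW.
- have c0 : 0 < `|c| + 1 by rewrite ltr_wpDl.
  have [|r r0 Hr] := Ha (e / 2 / (`|c| + 1)); first by rewrite !divr_gt0.
  have [|r' r'0 Hr'] := Hb (e / 2); first by rewrite divr_gt0.
  exists (Num.min r r'); first by rewrite lt_min r0 r'0.
  move=> phi psi cphi cpsi near.
  have [minl minr] : Num.min r r' <= r /\ Num.min r r' <= r'.
    by rewrite !ge_min !lexx orbT.
  have := Hr _ _ cphi cpsi (fun i => le_trans (near i) minl).
  have := Hr' _ _ cphi cpsi (fun i => le_trans (near i) minr).
  case: cphi cpsi => + _ _ [+ _ _] => -> ->.
  rewrite opprD addrACA -mulrBr => hb ha.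
  rewrite (le_trans (ler_normD _ _))// [leRHS]splitr lerD// normrM.
  rewrite ler_pdivlMr// in ha; apply: le_trans ha.
  by rewrite mulrC ler_wpM2l// lerDl.
- have [ca ca0 Ca] := char_bounded a; have [cb cb0 Cb] := char_bounded b.
  have [|r r0 Hr] := Ha (e / 2 / cb); first by rewrite !divr_gt0.
  have [|r' r'0 Hr'] := Hb (e / 2 / ca); first by rewrite !divr_gt0.
  exists (Num.min r r'); first by rewrite lt_min r0 r'0.
  move=> phi psi cphi cpsi near.
  have [minl minr] : Num.min r r' <= r /\ Num.min r r' <= r'.
    by rewrite !ge_min !lexx orbT.
  have := Hr _ _ cphi cpsi (fun i => le_trans (near i) minl).
  have := Hr' _ _ cphi cpsi (fun i => le_trans (near i) minr).
  rewrite (ler_pdivlMr _ _ ca0) (ler_pdivlMr _ _ cb0).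
  have := Ca _ cphi; have := Cb _ cpsi.
  case: cphi cpsi => _ [_ +] _ [_ [_ +] _] => -> -> hb ha Hb1 Ha1.
  rewrite (_ : _ - _ = phi a * (phi b - psi b) + psi b * (phi a - psi a)); last ring.
  rewrite (le_trans (ler_normD _ _))// [leRHS]splitr lerD// normrM.
    by rewrite (le_trans _ Hb1)// mulrC ler_wpM2l.
  by rewrite (le_trans _ Ha1)// mulrC ler_wpM2l.
Qed.
End Characters.

(** * Approximation by finite rank positive maps *)

Section Approximation.
Variables (R : realType) (A : comAlgType R) (S : set A).
Hypotheses (semiringS : is_semiring S) (archS : archimedean S).
Hypothesis fgA : finitely_generated A.

(** The weights [b] are products of Bernstein weights in the generators, hence a
    partition of unity inside [S].  The weight at a grid point [al] concentrates near that
    point, and [v al] is a character near it when there is one.  At the grid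
    points far from all characters, [v al] is [0]: their total weight is small
    at every character. *)
Lemma finite_rank_approximation N (a : nat -> A) (e : R) : 0 < e ->
  exists (I : finType) (b : I -> A) (v : I -> A -> R),
    [/\ forall i, S (b i), forall i, char S (v i) \/ v i = (fun=> 0) &
      forall phi, char S phi -> forall j, (j < N)%N ->
        `|phi (a j) - \sum_i v i (a j) * phi (b i)| <= e].
Proof.
move=> e0.
have [d [y [Sy y_gen]]] := unit_interval_generators semiringS archS fgA.
have e20 : 0 < e / 2 by rewrite divr_gt0.
(* One radius [r] and one bound [c] serve all the [a j]. *)
have [r [c [r0 c0 rcP]]] : exists r c : R, [/\ 0 < r, 0 < c &
    forall j, (j < N)%N -> (forall phi, char S phi -> `|phi (a j)| <= c) /\
      forall phi psi, char S phi -> char S psi ->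
        (forall i, `|phi (y i) - psi (y i)| <= r + r) ->
        `|phi (a j) - psi (a j)| <= e / 2].
  elim: N => [|N [r [c [r0 c0 IH]]]]; first by exists 1, 1; split.
  have [c' c'0 cP] := char_bounded archS (a N).
  have [r' r'0 rP] := char_unif_continuous archS y_gen (a N) e20.
  exists (Num.min r (r' / 2)), (Num.max c c'); split.
  - by rewrite lt_min r0 divr_gt0.
  - by rewrite lt_max c0.
  have rr : Num.min r (r' / 2) + Num.min r (r' / 2) <= r + r.
    by rewrite lerD// ge_min lexx.
  have rr' : Num.min r (r' / 2) + Num.min r (r' / 2) <= r'.
    by rewrite [leRHS]splitr lerD// ge_min lexx orbT.
  move=> j; rewrite ltnS leq_eqVlt => /orP[/eqP ->|/IH[IH1 IH2]]; split.
  - by move=> phi /cP le; rewrite le_max le orbT.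
  - by move=> phi psi cphi cpsi near; apply: rP => // i; exact: le_trans rr'.
  - by move=> phi /IH1 le; rewrite le_max le.
  - by move=> phi psi cphi cpsi near; apply: IH2 => // i; exact: le_trans rr.
(* Chebyshev: the weight at distance at least [r] is at most the variance,
   itself at most [d / n], divided by [r ^ 2]. *)
pose C := (c + c) / r ^+ 2.
have C0 : 0 < C by rewrite divr_gt0 ?exprn_gt0 ?addr_gt0.
pose n := (Num.bound (C * d%:R / (e / 2))).+1.
have nP : C * d%:R / n%:R <= e / 2.
  rewrite ler_pdivrMr ?ltr0n// [leRHS]mulrC -ler_pdivrMr//.
  apply: le_trans (ltW (archi_boundP _)) _; last by rewrite /n ler_nat.
  by rewrite divr_ge0 ?(ltW e20)// mulr_ge0// ltW.
have n0 : 0 < n%:R :> R by rewrite ltr0n.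
pose b (al : {ffun 'I_d -> 'I_n.+1}) := \prod_i bernstein n (y i) (al i).
have /choice[v vP] (al : {ffun 'I_d -> 'I_n.+1}) : exists w : A -> R,
    (char S w /\ forall i, `|(al i)%:R / n%:R - w (y i)| <= r) \/
    (w = (fun=> 0) /\ forall psi, char S psi ->
       exists i, r < `|(al i)%:R / n%:R - psi (y i)|).
  have [[w [cw wP]]|nw] := pselect (exists w : A -> R, char S w /\
      forall i, `|(al i)%:R / n%:R - w (y i)| <= r); first by exists w; left.
  exists (fun=> 0); right; split => // psi cpsi; apply: contrapT => far.
  apply: nw; exists psi; split => // i; rewrite leNgt; apply/negP => lt.
  by apply: far; exists i.
exists {ffun 'I_d -> 'I_n.+1}, b, v; split.
- move=> al; rewrite /b; apply: (big_ind S) => [||i _].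
  + exact: semiring1.
  + by move=> ? ? ? ?; exact: semiringM.
  + rewrite /bernstein -scaler_nat; apply: semiringZ => //.
    have [S1 S2] := Sy i.
    have SX x k : S x -> S (x ^+ k).
      move=> Sx; elim: k => [|k IH]; rewrite ?expr0 ?exprS; first exact: semiring1.
      exact: semiringM.
    by apply: semiringM => //; exact: SX.
- by move=> al; have [[cv _]|[v0 _]] := vP al; [left|right].
move=> phi cphi j jN; have [bound unif] := rcP j jN.
pose x i := phi (y i).
have x01 i : 0 <= x i <= 1.
  have [S1 S2] := Sy i; rewrite (char_ge0 cphi S1)/= -subr_ge0.
  by rewrite -(char1 cphi) -(charB cphi) (char_ge0 cphi).
have phib al : phi (b al) = \prod_i bernstein n (x i) (al i).
  rewrite /b (char_prod cphi); apply: eq_bigr => i _.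
  rewrite /bernstein -scaler_nat (charZ cphi) (charM cphi) !(charX cphi).
  by rewrite (charB cphi) (char1 cphi) mulr_natl.
have phib0 al : 0 <= phi (b al).
  rewrite phib; apply: prodr_ge0 => i _; have /andP[x0 x1] := x01 i.
  by rewrite /bernstein mulrn_wge0// mulr_ge0// exprn_ge0// subr_ge0.
have sumb : \sum_al phi (b al) = 1.
  by under eq_bigr do rewrite phib; exact: sum_bernstein_prod.
have far al : `|phi (a j) - v al (a j)| <=
    e / 2 + C * \sum_i ((al i)%:R / n%:R - x i) ^+ 2.
  have sum0 (P : pred 'I_d) : 0 <= \sum_(i | P i) ((al i)%:R / n%:R - x i) ^+ 2.
    by apply: sumr_ge0 => i _; exact: sqr_ge0.
  have [near|/existsNP[i0 /negP]] :=
      pselect (forall i, `|(al i)%:R / n%:R - x i| <= r).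
    rewrite (@le_trans _ _ (e / 2))//; last by rewrite lerDl mulr_ge0// ltW.
    have [[cv vnear]|[_ /(_ phi cphi)[i]]] := vP al; last by rewrite ltNge near.
    apply: unif => // i.
    have -> : phi (y i) - v al (y i) =
       ((al i)%:R / n%:R - v al (y i)) - ((al i)%:R / n%:R - x i) by rewrite /x; ring.
    by rewrite (le_trans (ler_normB _ _))// lerD.
  rewrite -ltNge => lt.
  have vb : `|v al (a j)| <= c.
    by have [[cv _]|[-> _]] := vP al; [exact: bound|rewrite normr0 ltW].
  rewrite (le_trans (ler_normB _ _))// (@le_trans _ _ (c + c))//.
    by rewrite lerD// bound.
  apply: ler_wpDl; first exact: ltW.
  rewrite /C -mulrA ler_peMr//; first by rewrite addr_ge0// ltW.
  rewrite mulrC ltW// ltr_pdivlMr ?exprn_gt0// mul1r.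
  rewrite (bigD1 i0)//= ltr_wpDr//.
  by rewrite -[ltRHS]real_normK ?num_real// ltr_pXn2r// ?nnegrE ltW.
have -> : phi (a j) - \sum_al v al (a j) * phi (b al) =
    \sum_al phi (b al) * (phi (a j) - v al (a j)).
  under [RHS]eq_bigr do rewrite mulrBr [X in _ - X]mulrC.
  by rewrite sumrB -mulr_suml sumb mul1r.
rewrite (le_trans (ler_norm_sum _ _ _))//.
rewrite (@le_trans _ _ (\sum_al phi (b al) *
   (e / 2 + C * \sum_i ((al i)%:R / n%:R - x i) ^+ 2)))//.
  apply: ler_sum => al _; rewrite normrM (ger0_norm (phib0 al)).
  by rewrite ler_wpM2l.
under eq_bigr do rewrite mulrDr [X in _ + X]mulrCA.
rewrite big_split/= -mulr_suml sumb mul1r -mulr_sumr [leRHS]splitr lerD2l.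
apply: le_trans nP.
under eq_bigr do rewrite mulr_sumr.
rewrite exchange_big/= -mulrA ler_pM2l//.
rewrite (@le_trans _ _ (\sum_(i < d) n%:R^-1))//; last first.
  by rewrite sumr_const card_ord mulr_natl.
apply: ler_sum => i _.
under eq_bigr do rewrite phib.
rewrite (bernstein_prod_marginal n x i (fun k => (k%:R / n%:R - x i) ^+ 2)).
have -> : \sum_(k < n.+1) bernstein n (x i) k * (k%:R / n%:R - x i) ^+ 2 =
    (n%:R ^+ 2)^-1 * \sum_(k < n.+1) bernstein n (x i) k * (k%:R - n%:R * x i) ^+ 2.
  rewrite mulr_sumr; apply: eq_bigr => k _; rewrite [RHS]mulrCA.
  by congr (_ * _); field; rewrite gt_eqF.
rewrite bernstein_variance subrr expr0n addr0.
have -> : (n%:R ^+ 2)^-1 * (n%:R * (x i * (1 - x i))) = n%:R^-1 * (x i * (1 - x i)) :> R.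
  by move: (n%:R : R) (x i) n0 => m z m0; field; rewrite gt_eqF.
have /andP[x0 x1] := x01 i.
by rewrite ler_piMr ?invr_ge0 ?ltW// ; nra.
Qed.
End Approximation.

(** * Positivity of the functional on nonnegative polynomials *)

Section Positivity.
Variables (R : realType) (A : comAlgType R) (S : set A) (J : set R).
Variable L : {poly A} -> R.
Hypotheses (semiringS : is_semiring S) (archS : archimedean S).
Hypothesis fgA : finitely_generated A.
Hypothesis linL : real_linear L.
Hypothesis posL : forall f, tensor_Pos S J f -> 0 <= L f.

Definition eval (f : {poly A}) (x : (A -> R) * R) : R := x.1 f.[x.2%:A].

Lemma eval_char f phi t : char S phi ->
  eval f (phi, t) = \sum_(i < size f) phi f`_i * t ^+ i.
Proof.
move=> cphi; rewrite /eval/= horner_coef (char_sum cphi).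
by apply: eq_bigr => i _; rewrite (charM cphi) (charX cphi) (charC cphi).
Qed.

Lemma functional0 : L 0 = 0.
Proof. by have := linL (-1) 0 0; rewrite scaler0 addr0 mulN1r addNr. Qed.

Lemma functionalD f g : L (f + g) = L f + L g.
Proof. by have := linL 1 f g; rewrite !scale1r mul1r. Qed.

Lemma functionalZ c f : L (c%:A *: f) = c * L f.
Proof. by rewrite -[_ *: _]addr0 linL functional0 addr0. Qed.

Lemma functionalN f : L (- f) = - L f.
Proof. by rewrite -[RHS]mulN1r -functionalZ !scaleN1r. Qed.

Lemma functional_sum I (s : seq I) (P : pred I) (F : I -> {poly A}) :
  L (\sum_(i <- s | P i) F i) = \sum_(i <- s | P i) L (F i).
Proof. by apply: big_morph; [exact: functionalD|exact: functional0]. Qed.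

Let incl (p : {poly R}) : {poly A} := map_poly (in_alg A) p.

Lemma functional_tensor_ge0 b p : S b -> Pos J p -> 0 <= L (b *: incl p).
Proof.
move=> Sb Jp; apply: posL; exists 1%N, (fun=> b), (fun=> p).
by split=> //; rewrite big_ord1.
Qed.

(** An [a] between [-e] and [e] on the characters satisfies [2 e + a \in S]. *)
Lemma functional_tensor_le a p e : 0 < e ->
  (forall phi, char S phi -> `|phi a| <= e) -> Pos J p ->
  `|L (a *: incl p)| <= (e + e) * L (incl p).
Proof.
move=> e0 ae Jp.
have S1 : S ((e + e)%:A + a).
  apply: archimedean_positivstellensatz => // phi cphi.
  by rewrite (charD cphi) (charC cphi); have := ae _ cphi; rewrite ler_norml; lra.
have S2 : S ((e + e)%:A - a).
  apply: archimedean_positivstellensatz => // phi cphi.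
  by rewrite (charB cphi) (charC cphi); have := ae _ cphi; rewrite ler_norml; lra.
have := functional_tensor_ge0 S1 Jp; have := functional_tensor_ge0 S2 Jp.
rewrite [(_ - a) *: _]scalerBl [(_ + a) *: _]scalerDl.
by rewrite !functionalD functionalN functionalZ ler_norml; lra.
Qed.

(** [t ^ i] is the difference of the squares of [(t ^ i + 1) / 2] and
    [(t ^ i - 1) / 2]. *)
Lemma functional_monomial_le i : exists2 C : R, 0 <= C &
  forall a e, 0 < e -> (forall phi, char S phi -> `|phi a| <= e) ->
    `|L (a *: 'X^i)| <= e * C.
Proof.
pose p : {poly R} := ((2^-1)%:P * ('X^i + 1)) ^+ 2.
pose q : {poly R} := ((2^-1)%:P * ('X^i - 1)) ^+ 2.
have Jp : Pos J p by move=> t _; rewrite /p horner_exp sqr_ge0.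
have Jq : Pos J q by move=> t _; rewrite /q horner_exp sqr_ge0.
have XE : 'X^i = incl p - incl q.
  rewrite -(map_polyXn (in_alg A)) /incl -rmorphB; congr (map_poly _ _).
  have two : (2^-1)%:P * 2%:R = 1 :> {poly R}.
    by rewrite -polyC_natr -polyCM mulVf ?pnatr_eq0.
  transitivity (((2^-1)%:P * 2%:R) ^+ 2 * 'X^i : {poly R}).
    by rewrite two expr1n mul1r.
  by rewrite /p /q; move: 'X^i (2^-1)%:P => u c; ring.
have L0 r : Pos J r -> 0 <= L (incl r).
  by move=> Jr; rewrite -[incl r]scale1r functional_tensor_ge0//; exact: semiring1.
exists (L (incl p) + L (incl p) + (L (incl q) + L (incl q))).
  by rewrite !addr_ge0 ?L0.
move=> a e e0 ae; rewrite XE scalerBr functionalD functionalN.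
rewrite (le_trans (ler_normB _ _))//.
have := functional_tensor_le e0 ae Jp; have := functional_tensor_le e0 ae Jq.
by lra.
Qed.

(** The crux: writing the coefficients as [f_j = \sum_i v_i (f_j) b_i + e_j] by
    [finite_rank_approximation] makes [f] the sum of the tensors
    [b_i * f(v_i, z)], whose factors lie in [S] and [Pos J], and of a small
    remainder. *)
Theorem functional_ge0 f :
  (forall phi t, char S phi -> J t -> 0 <= eval f (phi, t)) -> 0 <= L f.
Proof.
move=> fpos.
have /choice[C CP] i : exists C : R, 0 <= C /\
  forall a e, 0 < e -> (forall phi, char S phi -> `|phi a| <= e) ->
    `|L (a *: 'X^i)| <= e * C.
  by have [C C0 CP] := functional_monomial_le i; exists C.
pose D := \sum_(j < size f) C j.
have D0 : 0 <= D by apply: sumr_ge0 => j _; have [] := CP j.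
have D10 : 0 < D + 1 by rewrite ltr_wpDl.
suff main e : 0 < e -> - (e * D) <= L f.
  rewrite -oppr_le0; apply/ler_addgt0Pl => e e0; rewrite addr0.
  have e'0 : 0 < e / (D + 1) by rewrite divr_gt0.
  rewrite -[leRHS]opprK lerN2 (le_trans _ (main _ e'0))// lerN2.
  by rewrite -mulrA ler_piMr ?(ltW e0)// mulrC ler_pdivrMr// mul1r lerDl.
move=> e0.
have [I [b [v [Sb cv approx]]]] :=
  finite_rank_approximation semiringS archS fgA (size f) (fun j => f`_j) e0.
pose r j := f`_j - \sum_i (v i f`_j) *: b i.
pose p i := \poly_(j < size f) v i f`_j.
have Jp i : Pos J (p i).
  move=> t Jt; rewrite horner_poly.
  have [cvi|->] := cv i; first by rewrite -(eval_char _ _ cvi) fpos.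
  by rewrite big1// => j _; rewrite mul0r.
have fE : f = \sum_(j < size f) r j *: 'X^j + \sum_i b i *: incl (p i).
  rewrite -{1}[f]coefK poly_def.
  have -> : \sum_i b i *: incl (p i) =
      \sum_(j < size f) (\sum_i (v i f`_j) *: b i) *: 'X^j.
    under [RHS]eq_bigr do rewrite scaler_suml.
    rewrite exchange_big/=; apply: eq_bigr => i _.
    rewrite /incl /p poly_def rmorph_sum/= scaler_sumr; apply: eq_bigr => j _.
    rewrite map_polyZ map_polyXn scalerA -[v i _ *: b i]mulr_algr.
    by [].
  by rewrite -big_split/=; apply: eq_bigr => j _; rewrite -scalerDl /r subrK.
rewrite {1}fE functionalD !functional_sum -[leLHS]addr0 lerD//; last first.
  by apply: sumr_ge0 => i _; exact: functional_tensor_ge0.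
suff : `|\sum_(j < size f) L (r j *: 'X^j)| <= e * D by rewrite ler_norml => /andP[].
rewrite (le_trans (ler_norm_sum _ _ _))// /D mulr_sumr; apply: ler_sum => j _.
have [_] := CP j; apply => // phi cphi.
rewrite /r (charB cphi) (char_sum cphi).
under eq_bigr do rewrite (charZ cphi).
exact: approx.
Qed.
End Positivity.

(** * Extension of positive functionals *)

Section PositiveExtension.
Variables (R : realType) (T : Type) (X : set T).

(** A positive functional on a space of functions is handled as its graph, so
    that an extension is an inclusion.  Positivity on [X] makes the graph
    single-valued. *)
Definition linear_graph (G : set ((T -> R) * R)) : Prop :=
  forall (c : R) g r h s, G (g, r) -> G (h, s) ->
    G ((fun x => c * g x + h x), c * r + s).

Definition positive_graph (G : set ((T -> R) * R)) : Prop :=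
  forall g r, G (g, r) -> (forall x, X x -> 0 <= g x) -> 0 <= r.

Definition dominated (G : set ((T -> R) * R)) (g : T -> R) : Prop :=
  exists h r, G (h, r) /\ forall x, X x -> `|g x| <= h x.

Lemma positive_graph_le G g r h s : linear_graph G -> positive_graph G ->
  G (g, r) -> G (h, s) -> (forall x, X x -> g x <= h x) -> r <= s.
Proof.
move=> linG posG Gg Gh gh; rewrite -subr_ge0.
have := posG _ _ (linG (-1) _ _ _ _ Gg Gh); rewrite mulN1r addrC; apply => x Xx.
by rewrite mulN1r addrC subr_ge0 gh.
Qed.

(** The new value at [g] is the supremum of the values at the functions below
    [g]. *)
Lemma extend_positive_graph G g : G ((fun=> 0), 0) ->
  linear_graph G -> positive_graph G -> dominated G g ->
  exists c, positive_graph
    [set p | exists h r k, G (h, r) /\ p = ((fun x => h x + k * g x), r + k * c)].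
Proof.
move=> G0 linG posG [h0 [r0 [Gh0 gh0]]].
have GZ c h r : G (h, r) -> G ((fun x => c * h x), c * r).
  move=> Gh; have := linG c _ _ _ _ Gh G0; rewrite addr0; congr (G (_, _)).
  by apply/funext => x; rewrite addr0.
pose E := [set r : R | exists h, G (h, r) /\ forall x, X x -> h x <= g x].
have E0 : E !=set0.
  exists (-1 * r0), (fun x => -1 * h0 x); split; first exact: GZ.
  by move=> x /gh0; rewrite mulN1r ler_norml => /andP[].
have Eub h r : G (h, r) -> (forall x, X x -> g x <= h x) -> ubound E r.
  move=> Gh gh s [h' [Gh' h'g]]; apply: (positive_graph_le linG posG Gh' Gh).
  by move=> x Xx; rewrite (le_trans (h'g _ Xx)) ?gh.
have supE : has_sup E.
  split=> //; exists r0; apply: Eub Gh0 _ => x /gh0.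
  by rewrite ler_norml => /andP[].
exists (sup E) => _ _ [h [r [k [Gh [-> ->]]]]] pos.
have divE u : - k^-1 * u = - u / k by ring.
have [k0|k0|k0] := ltgtP k 0.
- have : sup E <= - k^-1 * r.
    apply: ge_sup => //; apply: Eub (GZ _ _ _ Gh) _ => x /pos.
    rewrite divE ler_ndivlMr// mulrC; lra.
  rewrite divE ler_ndivlMr// mulrC; lra.
- have : - k^-1 * r <= sup E.
    apply: ub_le_sup; first exact: supE.2.
    exists (fun x => - k^-1 * h x); split; first exact: GZ.
    by move=> x /pos; rewrite divE ler_pdivrMr// mulrC; lra.
  by rewrite divE ler_pdivrMr// mulrC; lra.
- rewrite k0 mul0r addr0; apply: posG Gh _ => x /pos.
  by rewrite k0 mul0r addr0.
Qed.

Theorem positive_extension (G : set ((T -> R) * R)) : G ((fun=> 0), 0) ->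
  linear_graph G -> positive_graph G ->
  exists F : (T -> R) -> R,
    [/\ forall g r, G (g, r) -> F g = r,
        forall c g h, dominated G g -> dominated G h ->
          F (fun x => c * g x + h x) = c * F g + F h &
        forall g, dominated G g -> (forall x, X x -> 0 <= g x) -> 0 <= F g].
Proof.
move=> G0 linG posG.
have [|M [GM [linM posM] maxM]] :=
    @zorn_above _ [set H | linear_graph H /\ positive_graph H] G (conj linG posG).
  move=> C _ CP Ctot; split.
    move=> c g r h s [H1 CH1 gr] [H2 CH2 hs].
    have [H12|H21] := Ctot _ _ CH1 CH2.
      by exists H2 => //; apply: (CP _ CH2).1 => //; exact: H12.
    by exists H1 => //; apply: (CP _ CH1).1 => //; exact: H21.
  by move=> g r [H CH]; exact: (CP _ CH).2.
have M0 : M ((fun=> 0), 0) by exact: GM.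
have Mdom g : dominated G g -> exists r, M (g, r).
  move=> [h0 [r0 [Gh0 gh0]]].
  have [|c posN] := extend_positive_graph M0 linM posM (g := g).
    by exists h0, r0; split => //; exact: GM.
  exists c; rewrite -(maxM _ _ (conj _ posN)).
  - exists (fun=> 0), 0, 1; split => //; congr (_, _); last by rewrite add0r mul1r.
    by apply/funext => x; rewrite add0r mul1r.
  - move=> [h r] Mh; exists h, r, 0; split => //; congr (_, _); last first.
      by rewrite mul0r addr0.
    by apply/funext => x; rewrite mul0r addr0.
  - move=> d _ _ _ _ [h [r [k [Mh [-> ->]]]]] [h' [r' [k' [Mh' [-> ->]]]]].
    exists (fun x => d * h x + h' x), (d * r + r'), (d * k + k').
    split; [exact: linM|congr (_, _); last by ring].
    by apply/funext => x; ring.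
have Muniq g r s : M (g, r) -> M (g, s) -> r = s.
  by move=> gr gs; apply/le_anti; rewrite !(positive_graph_le linM posM (g := g) (h := g)).
pose F g := xget 0 [set r | M (g, r)].
have FE g r : M (g, r) -> F g = r.
  move=> gr; apply: (Muniq g) => //.
  by apply: (@xgetPex _ 0 [set r | M (g, r)]); exists r.
exists F; split.
- by move=> g r /GM; exact: FE.
- move=> c g h /Mdom[r gr] /Mdom[s hs]; apply: (FE).
  by rewrite (FE _ _ gr) (FE _ _ hs); exact: linM.
- by move=> g /Mdom[r gr] g0; rewrite (FE _ _ gr); exact: posM gr g0.
Qed.
End PositiveExtension.

(** * Positive functionals as integrals over nested intervals *)

Lemma ler_dist_sandwich (R : realDomainType) (lo hi x y : R) :
  lo <= x -> x <= hi -> lo <= y -> y <= hi -> `|x - y| <= hi - lo.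
Proof. by rewrite ler_norml; lra. Qed.

Section NestedIntervals.
Variables (R : realType) (T : pointedType) (X : set T) (beta : nat -> T -> bool).
Variable F : (T -> R) -> R.

Definition bounded_on (u : T -> R) : Prop :=
  exists C : R, forall x, X x -> `|u x| <= C.

Hypothesis F_linear : forall c u v, bounded_on u -> bounded_on v ->
  F (fun x => c * u x + v x) = c * F u + F v.
Hypothesis F_ge0 : forall u, bounded_on u -> (forall x, X x -> 0 <= u x) -> 0 <= F u.

Lemma bounded_on_cst (a : R) : bounded_on (fun=> a).
Proof. by exists `|a|. Qed.

Lemma bounded_onD u v : bounded_on u -> bounded_on v -> bounded_on (fun x => u x + v x).
Proof.
move=> [C uC] [D vD]; exists (C + D) => x Xx.
by rewrite (le_trans (ler_normD _ _))// lerD ?uC ?vD.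
Qed.

Lemma bounded_onM u v : bounded_on u -> bounded_on v -> bounded_on (fun x => u x * v x).
Proof.
move=> [C uC] [D vD]; exists (C * D) => x Xx.
by rewrite normrM ler_pM ?uC ?vD.
Qed.

Lemma bounded_on_indic (B : set T) : bounded_on (\1_B : T -> R).
Proof. by exists 1 => x _; rewrite indicE; case: (x \in B); rewrite ?normr1 ?normr0. Qed.

Hint Resolve bounded_on_cst bounded_on_indic : core.

Lemma functional_cst0 : F (fun=> 0) = 0.
Proof.
suff : F (fun=> 0) = - 1 * F (fun=> 0) + F (fun=> 0) by rewrite mulN1r addNr.
rewrite -F_linear//; congr F.
by apply/funext => x; rewrite mulr0 addr0.
Qed.

Lemma positive_functionalD u v : bounded_on u -> bounded_on v -> F (fun x => u x + v x) = F u + F v.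
Proof.
move=> bu bv; have := F_linear 1 bu bv; rewrite mul1r => <-; congr F.
by apply/funext => x; rewrite mul1r.
Qed.

Lemma positive_functionalZ c u : bounded_on u -> F (fun x => c * u x) = c * F u.
Proof.
move=> bu; have := F_linear c bu (bounded_on_cst 0); rewrite functional_cst0 addr0 => <-.
by congr F; apply/funext => x; rewrite addr0.
Qed.

Lemma positive_functional_le u v : bounded_on u -> bounded_on v -> (forall x, X x -> u x <= v x) ->
  F u <= F v.
Proof.
move=> bu bv uv; rewrite -subr_ge0 addrC -mulN1r -F_linear//.
apply: F_ge0; last by move=> x Xx; rewrite mulN1r addrC subr_ge0 uv.
by apply: bounded_onD => //; exact: bounded_onM.
Qed.

Lemma positive_functional_eq u v : bounded_on u -> bounded_on v -> (forall x, X x -> u x = v x) ->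
  F u = F v.
Proof. by move=> bu bv uv; apply/le_anti; rewrite !positive_functional_le// => x /uv ->. Qed.

(** * Cells and intervals *)

Definition cell (c : seq bool) : set T :=
  [set x | X x /\ mkseq (beta^~ x) (size c) = c].

Lemma cellE c b x : cell (rcons c b) x <-> cell c x /\ beta (size c) x = b.
Proof.
rewrite /cell/= size_rcons mkseqS; split=> [[Xx /rcons_inj[-> ->]]|[[Xx ->] ->]] //.
Qed.

Definition mass (c : seq bool) : R := F \1_(cell c).

Lemma mass_ge0 c : 0 <= mass c.
Proof. by apply: F_ge0 => // x _; rewrite indicE ler0n. Qed.

Lemma indic_cell c x :
  \1_(cell c) x = \1_(cell (rcons c false)) x + \1_(cell (rcons c true)) x :> R.
Proof.
rewrite !indicE; have [cx|cx] := pselect (cell c x); last first.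
  by rewrite !memNset ?addr0// => /cellE[].
rewrite (mem_set cx); case bx: (beta (size c) x).
  by rewrite memNset ?mem_set ?add0r//; [exact/cellE|move/cellE; rewrite bx => -[]].
by rewrite mem_set ?memNset ?addr0//; [move/cellE; rewrite bx => -[]|exact/cellE].
Qed.

Lemma mass_rcons c : mass c = mass (rcons c false) + mass (rcons c true).
Proof.
by rewrite /mass -positive_functionalD//; congr F; apply/funext => x; exact: indic_cell.
Qed.

Lemma mass_gt0 c : 0 < mass c -> cell c !=set0.
Proof.
move=> c0; apply/set0P/eqP => ce; move: c0.
rewrite /mass ce (_ : \1_set0 = (fun=> 0)) ?functional_cst0 ?ltxx//.
by apply/funext => x; rewrite indicE in_set0.
Qed.

Definition left_end (c : seq bool) : R :=
  \sum_(k < size c) (if nth false c k then mass (rcons (take k c) false) else 0).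

Lemma left_end_rcons c b : left_end (rcons c b) =
  left_end c + (if b then mass (rcons c false) else 0).
Proof.
rewrite /left_end size_rcons big_ord_recr/= nth_rcons ltnn eqxx -cats1.
rewrite take_cat ltnn subnn take0 cats0; congr (_ + _); apply: eq_bigr => k _.
by rewrite nth_cat take_cat ltn_ord.
Qed.

(** Half-open, so that the intervals of the two children of [c] partition that of
    [c] exactly as their cells partition [cell c]. *)
Definition cell_itv (c : seq bool) : set R := `[left_end c, left_end c + mass c[%classic.

Lemma itvP c t : cell_itv c t <-> left_end c <= t < left_end c + mass c.
Proof. by rewrite /cell_itv/= in_itv. Qed.

Lemma itv_rcons c : cell_itv c = cell_itv (rcons c false) `|` cell_itv (rcons c true).
Proof.
have m0 := mass_ge0 (rcons c false); have m1 := mass_ge0 (rcons c true).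
apply/seteqP; split=> t; rewrite /setU/= !itvP !left_end_rcons (mass_rcons c) !addr0.
  move=> /andP[t1 t2]; have [lt|le] := ltP t (left_end c + mass (rcons c false)).
    by left; rewrite t1.
  by right; rewrite -addrA t2.
case=> /andP[t1 t2]; apply/andP; split; lra.
Qed.

Lemma itv_disjoint c : [disjoint cell_itv (rcons c false) & cell_itv (rcons c true)].
Proof.
apply/disj_setPS => t []; rewrite !itvP !left_end_rcons addr0.
by move=> /andP[_ t1] /andP[t2 _]; lra.
Qed.

(** The labels of the intervals around [t]: at each step [t] lies in the left
    part, of label [false], or in the right part. *)
Fixpoint cell_code (t : R) (n : nat) : seq bool :=
  if n is n'.+1 then
    let c := cell_code t n' in rcons c (left_end c + mass (rcons c false) <= t)
  else [::].

Lemma size_code t n : size (cell_code t n) = n.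
Proof. by elim: n => //= n IH; rewrite size_rcons IH. Qed.

Lemma itv_code t n : cell_itv [::] t -> cell_itv (cell_code t n) t.
Proof.
move=> t0; elim: n => //= n; rewrite !itvP left_end_rcons (mass_rcons (cell_code t n)).
by case: (leP (_ + mass (rcons _ false)) t) => lt /andP[t1 t2]; apply/andP; split => //; lra.
Qed.

Lemma code_itv t c : cell_itv c t -> cell_code t (size c) = c.
Proof.
elim/last_ind: c => // c b IH; rewrite size_rcons/= => tc.
have /IH -> : cell_itv c t by rewrite itv_rcons; case: (b) tc; [right|left].
congr (rcons _ _); move: tc; rewrite itvP left_end_rcons; case: b.
  by move=> /andP[].
by rewrite addr0 => /andP[_ lt]; apply/negbTE; rewrite -ltNge.
Qed.

Lemma itv_root c t : cell_itv c t -> cell_itv [::] t.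
Proof.
elim/last_ind: c => // c b IH tc; apply: IH.
by rewrite itv_rcons; case: (b) tc; [right|left].
Qed.

Lemma measurable_itv_cell c : measurable (cell_itv c).
Proof. exact: measurable_itv. Qed.

Lemma lebesgue_itv c : lebesgue_measure (cell_itv c) = (mass c)%:E.
Proof.
rewrite /cell_itv lebesgue_measure_itv/= lte_fin.
have := mass_ge0 c; rewrite le_eqVlt => /predU1P[<-|c0].
  by rewrite addr0 ltxx.
by rewrite ltrDl c0 -EFinD addrAC subrr add0r.
Qed.

Lemma sub_itv_code t m n : (m <= n)%N -> cell_itv (cell_code t n) `<=` cell_itv (cell_code t m).
Proof.
move=> /subnK <-; elim: (n - m)%N => //= k IH s sk; apply: IH.
rewrite itv_rcons; move: sk; set b := (_ <= t).
by case: b => ?; [right|left].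
Qed.

(** A set that contains with each point an interval of the tree around it is a
    countable union of such intervals. *)
Lemma measurable_tree_open (B : set R) :
  (forall t, B t -> exists2 c, cell_itv c t & cell_itv c `<=` B) -> measurable B.
Proof.
move=> Bopen.
have -> : B = \bigcup_(c : seq bool) (if `[< cell_itv c `<=` B >] then cell_itv c else set0).
  apply/seteqP; split=> [t /Bopen[c ct cB]|t [c _]].
    by exists c => //; case: asboolP.
  by case: asboolP => // cB /cB.
apply: countable_bigcupT_measurable => // c.
by case: ifP => // _; exact: measurable_itv_cell.
Qed.

(** * Limits along the tree *)

(** The cells met here have positive mass, hence are not empty. *)
Definition sample (t : R) (n : nat) : T := get (cell (cell_code t n)).

Lemma cell_sample t n : cell_itv [::] t -> cell (cell_code t n) (sample t n).
Proof.
move=> /(itv_code n)/itvP /andP[t1 t2].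
have [x cx] : cell (cell_code t n) !=set0.
  by apply: mass_gt0; rewrite -(ltrD2l (left_end (cell_code t n))) addr0 (le_lt_trans t1).
exact: (@getPex _ (cell (cell_code t n)) (ex_intro _ x cx)).
Qed.

Lemma sub_cell_code t m n : (m <= n)%N -> cell (cell_code t n) `<=` cell (cell_code t m).
Proof.
move=> /subnK <-; elim: (n - m)%N => //= k IH x /cellE[/IH].
by [].
Qed.

Lemma cell_code_itv c t n : cell_itv c t -> (size c <= n)%N -> cell (cell_code t n) `<=` cell c.
Proof. by move=> /code_itv <- cn; apply: sub_cell_code; rewrite -(size_code t (size c)) size_code in cn *. Qed.

(** This is uniform continuity for the topology generated by the bits. *)
Definition resolved (u : T -> R) : Prop := forall e : R, 0 < e -> exists n,
  forall x y, X x -> X y -> (forall k, (k < n)%N -> beta k x = beta k y) ->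
    `|u x - u y| <= e.

Lemma resolved_cell u : resolved u -> forall e : R, 0 < e -> exists n,
  forall c x y, (n <= size c)%N -> cell c x -> cell c y -> `|u x - u y| <= e.
Proof.
move=> ru e e0; have [n Hn] := ru e e0; exists n => c x y nc [Xx cx] [Xy cy].
apply: Hn => // k kn; have kc : (k < size c)%N by exact: leq_trans nc.
by rewrite -(nth_mkseq false (beta^~ x) kc) cx -cy nth_mkseq.
Qed.

Lemma resolved_eq u v : (forall x, X x -> u x = v x) -> resolved u -> resolved v.
Proof.
move=> uv ru e e0; have [n Hn] := ru e e0; exists n => x y Xx Xy xy.
by rewrite -!uv//; exact: Hn.
Qed.

Lemma resolved_cst (a : R) : resolved (fun=> a).
Proof. by move=> e e0; exists 0%N => x y _ _ _; rewrite subrr normr0 ltW. Qed.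

Lemma resolvedD u v : resolved u -> resolved v -> resolved (fun x => u x + v x).
Proof.
move=> ru rv e e0; have e20 : 0 < e / 2 by rewrite divr_gt0.
have [n Hn] := ru _ e20; have [m Hm] := rv _ e20.
exists (maxn n m) => x y Xx Xy xy; rewrite opprD addrACA.
rewrite (le_trans (ler_normD _ _))// [leRHS]splitr lerD//.
  by apply: Hn => // k kn; apply: xy; rewrite leq_max kn.
by apply: Hm => // k km; apply: xy; rewrite leq_max km orbT.
Qed.

Lemma resolvedM u v : bounded_on u -> bounded_on v -> resolved u -> resolved v ->
  resolved (fun x => u x * v x).
Proof.
move=> [C uC] [D vD] ru rv e e0.
have D10 : 0 < `|D| + 1 by rewrite ltr_wpDl.
have C10 : 0 < `|C| + 1 by rewrite ltr_wpDl.
have [|n Hn] := ru (e / 2 / (`|D| + 1)); first by rewrite !divr_gt0.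
have [|m Hm] := rv (e / 2 / (`|C| + 1)); first by rewrite !divr_gt0.
exists (maxn n m) => x y Xx Xy xy.
rewrite (_ : _ - _ = (u x - u y) * v x + u y * (v x - v y)); last by ring.
rewrite (le_trans (ler_normD _ _))// [leRHS]splitr lerD// normrM.
  rewrite -[leRHS](@divfK _ (`|D| + 1)) ?gt_eqF// ler_pM//.
    by apply: Hn => // k kn; apply: xy; rewrite leq_max kn.
  by rewrite (le_trans (vD _ Xx))// (le_trans (ler_norm _))// lerDl.
rewrite mulrC -[leRHS](@divfK _ (`|C| + 1)) ?gt_eqF// ler_pM//.
  by apply: Hm => // k km; apply: xy; rewrite leq_max km orbT.
by rewrite (le_trans (uC _ Xy))// (le_trans (ler_norm _))// lerDl.
Qed.

Definition tree_lim (u : T -> R) (t : R) : R := lim (u (sample t n) @[n --> \oo]).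

Lemma resolved_cvg u t : resolved u -> cell_itv [::] t ->
  u (sample t n) @[n --> \oo] --> tree_lim u t.
Proof.
move=> ru t0; apply/cauchy_cvgP/cauchy_exP => e e0.
have [|n Hn] := resolved_cell ru (e := e / 2); first by rewrite divr_gt0.
exists (u (sample t n)); exists n => // m /= nm; rewrite /ball/=.
rewrite (le_lt_trans (Hn (cell_code t n) _ _ _ _ _))//.
- by rewrite size_code.
- exact: cell_sample.
- by apply: sub_cell_code nm _ _; exact: cell_sample.
- by rewrite ltr_pdivrMr// ltr_pMr// ltr1n.
Qed.

Lemma tree_lim_near u t (c : seq bool) x e : resolved u -> cell_itv c t ->
  (forall y, cell c y -> `|u x - u y| <= e) -> `|u x - tree_lim u t| <= e.
Proof.
move=> ru ct osc; apply/ler_addgt0Pl => d d0.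
have /cvgrPdist_le/(_ d d0)[N _ HN] := resolved_cvg ru (itv_root ct).
have mN : (N <= maxn N (size c))%N by rewrite leq_maxl.
set s := sample t (maxn N (size c)).
have -> : u x - tree_lim u t = (u x - u s) - (tree_lim u t - u s) by ring.
rewrite (le_trans (ler_normB _ _))// addrC lerD ?(HN _ mN)// osc//.
by apply: (cell_code_itv ct (leq_maxr N _)); apply: cell_sample; exact: itv_root ct.
Qed.

Lemma tree_lim_bounded u C t : resolved u -> (forall x, X x -> `|u x| <= C) ->
  cell_itv [::] t -> `|tree_lim u t| <= C.
Proof.
move=> ru uC t0; apply/ler_addgt0Pl => d d0.
have /cvgrPdist_le/(_ d d0)[N _ HN] := resolved_cvg ru t0.
have := HN N (leqnn N); have := uC _ (cell_sample N t0).1.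
set s := sample _ _ => sC sd.
have -> : tree_lim u t = (tree_lim u t - u s) + u s by ring.
by rewrite (le_trans (ler_normD _ _))// lerD.
Qed.

(** Both limits are close to the value at a common sample. *)
Lemma tree_lim_tree_continuous u t e : resolved u -> cell_itv [::] t -> 0 < e ->
  exists2 c, cell_itv c t & forall t', cell_itv c t' -> `|tree_lim u t - tree_lim u t'| <= e.
Proof.
move=> ru t0 e0; have e20 : 0 < e / 2 by rewrite divr_gt0.
have [n Hn] := resolved_cell ru e20.
exists (cell_code t n); first exact: itv_code.
move=> t' ct'; have cs := cell_sample n t0; set s := sample t n in cs.
have osc y : cell (cell_code t n) y -> `|u s - u y| <= e / 2.
  by move=> cy; apply: Hn cs cy; rewrite size_code.
have := tree_lim_near ru (itv_code n t0) osc; have := tree_lim_near ru ct' osc.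
move=> h' h.
have -> : tree_lim u t - tree_lim u t' = (u s - tree_lim u t') - (u s - tree_lim u t) by ring.
by rewrite (le_trans (ler_normB _ _))// [leRHS]splitr lerD.
Qed.

Lemma measurable_tree_lim u : resolved u -> measurable_fun (cell_itv [::]) (tree_lim u).
Proof.
move=> ru; apply: (measurability _ (RGenOInfty.measurableE R)).
move=> _ [_ [a ->] <-]; apply: measurable_tree_open => t [t0 /=].
rewrite in_itv/= andbT => lt.
have [|c ct cP] := tree_lim_tree_continuous ru t0 (e := (tree_lim u t - a) / 2).
  by rewrite divr_gt0// subr_gt0.
exists c => // t' ct'; split; first exact: itv_root ct'.
by rewrite /= in_itv/= andbT; have := cP _ ct'; rewrite ler_norml; lra.
Qed.

Lemma integrable_tree_lim u : bounded_on u -> resolved u ->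
  lebesgue_measure.-integrable (cell_itv [::]) (EFin \o tree_lim u).
Proof.
move=> [C uC] ru; apply: measurable_bounded_integrable => //.
- exact: measurable_itv_cell.
- by rewrite [X in (X < _)%E]lebesgue_itv ltry.
- exact: measurable_tree_lim.
- exists C; split; rewrite ?num_real// => D CD t t0 /=.
  by rewrite (le_trans (tree_lim_bounded ru uC t0))// ltW.
Qed.

(** The difference between the integral over [cell_itv c] and the value of [F] on
    [u] restricted to [cell c] is additive when [c] is split, and deep in the
    tree, where [u] oscillates by at most [e] on cells, it is at most [2 e] times
    the mass.  Hence it is as small at the root. *)
Theorem tree_integral u : bounded_on u -> resolved u ->
  Rintegral lebesgue_measure (cell_itv [::]) (tree_lim u) = F u.
Proof.
move=> bu ru; have intu := integrable_tree_lim bu ru.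
have intc c : lebesgue_measure.-integrable (cell_itv c) (EFin \o tree_lim u).
  apply: integrableS intu; [exact: measurable_itv_cell|exact: measurable_itv_cell|].
  exact: itv_root.
pose D c := Rintegral lebesgue_measure (cell_itv c) (tree_lim u) -
            F (fun x => \1_(cell c) x * u x).
have D_rcons c : D c = D (rcons c false) + D (rcons c true).
  rewrite /D itv_rcons Rintegral_setU; last exact: itv_disjoint.
  - rewrite (_ : F _ = F (fun x => \1_(cell (rcons c false)) x * u x) +
      F (fun x => \1_(cell (rcons c true)) x * u x)); first by ring.
    rewrite -positive_functionalD; [|exact: bounded_onM|exact: bounded_onM].
    by congr F; apply/funext => x; rewrite indic_cell mulrDl.
  - exact: measurable_itv_cell.
  - exact: measurable_itv_cell.
  - by rewrite -itv_rcons.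
have D_small e n : 0 < e -> (forall c x y, (n <= size c)%N ->
    cell c x -> cell c y -> `|u x - u y| <= e) ->
    forall k c, (k + size c)%N = n -> `|D c| <= (e + e) * mass c.
  move=> e0 osc; elim=> [|k IH] c kc; last first.
    rewrite D_rcons mass_rcons mulrDr (le_trans (ler_normD _ _))//.
    by rewrite lerD// IH// size_rcons addnS.
  have {osc} osc := osc c _ _ (eq_leq (esym kc)).
  have [[x cx]|ce] := pselect (cell c !=set0); last first.
    have m0 : mass c = 0.
      by apply/le_anti; rewrite mass_ge0 leNgt andbT; apply/negP => /mass_gt0.
    rewrite m0 mulr0 /D (_ : cell_itv c = set0).
      rewrite Rintegral_set0 sub0r normrN (_ : (fun _ => _) = (fun=> 0)) ?functional_cst0 ?normr0//.
      by apply/funext => x; rewrite indicE memNset ?mul0r// => cx; apply: ce; exists x.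
    by apply/seteqP; split=> // t /itvP; rewrite m0 addr0; case: ltgtP.
  have cstint a : lebesgue_measure.-integrable (cell_itv c) (EFin \o (fun=> a)).
    apply: measurable_bounded_integrable => //; first exact: measurable_itv_cell.
    - by rewrite [X in (X < _)%E]lebesgue_itv ltry.
    - by exists `|a|; split; rewrite ?num_real// => K aK t _ /=; rewrite ltW.
  have intcst a : Rintegral lebesgue_measure (cell_itv c) (fun=> a) = a * mass c.
    rewrite Rintegral_cst; last exact: measurable_itv_cell.
    by rewrite [X in fine X]lebesgue_itv.
  have bcu : bounded_on (fun y => \1_(cell c) y * u y) by exact: bounded_onM.
  have Fcst a : F (fun y => a * \1_(cell c) y) = a * mass c by exact: positive_functionalZ.
  have bcst a : bounded_on (fun y => a * \1_(cell c) y) by exact: bounded_onM.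
  have near t : cell_itv c t -> `|u x - tree_lim u t| <= e.
    by move=> ct; apply: tree_lim_near ct _ => // y cy; exact: osc.
  have I1 : (u x - e) * mass c <= Rintegral lebesgue_measure (cell_itv c) (tree_lim u).
    rewrite -intcst; apply: le_Rintegral => //; first exact: measurable_itv_cell.
    by move=> t /near; rewrite ler_distl lerBlDr => /andP[_]; rewrite lerBlDr.
  have I2 : Rintegral lebesgue_measure (cell_itv c) (tree_lim u) <= (u x + e) * mass c.
    rewrite -intcst; apply: le_Rintegral => //; first exact: measurable_itv_cell.
    by move=> t /near; rewrite ler_distl lerBlDr => /andP[].
  have F1 : (u x - e) * mass c <= F (fun y => \1_(cell c) y * u y).
    rewrite -Fcst positive_functional_le// => y _; rewrite indicE.
    have [cy|cy] := pselect (cell c y); last by rewrite memNset// mulr0 mul0r.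
    by have := osc _ _ cx cy; rewrite mem_set// mulr1 mul1r ler_norml; lra.
  have F2 : F (fun y => \1_(cell c) y * u y) <= (u x + e) * mass c.
    rewrite -Fcst positive_functional_le// => y _; rewrite indicE.
    have [cy|cy] := pselect (cell c y); last by rewrite memNset// mulr0 mul0r.
    by have := osc _ _ cx cy; rewrite mem_set// mulr1 mul1r ler_norml; lra.
  apply: le_trans (ler_dist_sandwich I1 I2 F1 F2) _.
  by rewrite -mulrBl opprB addrC addrA subrK.
suff : D [::] = 0.
  move/eqP; rewrite /D subr_eq0 => /eqP ->; apply: positive_functional_eq => // [|x Xx].
    exact: bounded_onM.
  by rewrite indicE mem_set ?mul1r.
apply/eqP; rewrite -normr_le0; apply/ler_addgt0Pl => d d0; rewrite addr0.
have m0 := mass_ge0 [::].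
have e0 : 0 < d / 2 / (mass [::] + 1) by rewrite !divr_gt0// ltr_wpDl.
have [n osc] := resolved_cell ru e0.
rewrite (le_trans (D_small _ n e0 osc n _ _)) ?addn0//.
have -> : d / 2 / (mass [::] + 1) + d / 2 / (mass [::] + 1) = d / (mass [::] + 1).
  by field; rewrite gt_eqF// ltr_wpDl.
by rewrite mulrAC ler_pdivrMr ?ltr_wpDl// ler_pM2l// lerDl.
Qed.
End NestedIntervals.

(** * The topology of the ambient space *)

(** The index set [T] has no topology; the neighborhoods of the subbasis, which
    restrict a single coordinate, suffice. *)
Lemma ptws_cvg (T I : Type) (V : topologicalType) (F : set_system I)
    (f : I -> {ptws T -> V}) (l : {ptws T -> V}) :
  Filter F -> (forall a, (f i) a @[i --> F] --> l a) -> f @ F --> l.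
Proof.
move=> FF fl; apply/cvg_sup => a B /=.
rewrite (@nbhsE (initial_topology (fun g : {ptws T -> V} => g a))) => -[U [[W oW <-] Wl] UB].
apply: (filterS UB); apply: (fl a); exact: open_nbhs_nbhs.
Qed.

Section Ambient.
Variables (R : realType) (A : comAlgType R).

Lemma ambient_cvg (I : Type) (F : set_system I) (f : I -> ambient A) (l : ambient A) :
  Filter F -> (forall a, (f i).1 a @[i --> F] --> l.1 a) ->
  (f i).2 @[i --> F] --> l.2 -> f @ F --> l.
Proof.
move=> FF f1 f2.
have g1 : (fun i => (f i).1 : {ptws A -> R}) @ F --> (l.1 : {ptws A -> R}).
  exact: ptws_cvg.
have fE : (fun i => ((f i).1, (f i).2)) = f by apply/funext => i; case: (f i).
have := cvg_pair g1 f2; rewrite fE; exact.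
Qed.

Lemma continuous_coord1 (a : A) : continuous (fun x : ambient A => x.1 a : R).
Proof.
move=> x.
apply: (@cvg_comp _ _ _ (fun x : ambient A => x.1) (fun g : {ptws A -> R} => g a) _
  (nbhs x.1)).
  exact: cvg_fst.
exact: (@proj_continuous A (fun=> R) a x.1).
Qed.

Lemma continuous_coord2 : continuous (fun x : ambient A => x.2 : R).
Proof. by move=> x; exact: cvg_snd. Qed.

(** The coordinates are continuous, real valued and separate points. *)
Lemma ambient_hausdorff : hausdorff_space (ambient A).
Proof.
have sep (g : ambient A -> R) : continuous g -> forall p q,
    cluster (nbhs p) q -> g p = g q.
  move=> cg p q pq; apply: (@Rhausdorff R) => B C Bp Cq.
  have [x [Bx Cx]] := pq _ _ (cg p B Bp) (cg q C Cq).
  by exists (g x).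
move=> [p1 p2] [q1 q2] pq; congr (_, _); last exact: (sep _ continuous_coord2 _ _ pq).
by apply/funext => a; have /= := sep _ (@continuous_coord1 a) _ _ pq.
Qed.

(** The set is cut out by equations and inequalities between continuous functions
    of the coordinates. *)
Lemma closed_char_setX (S : set A) (J : set R) :
  closed J -> closed (char S `*` J : set (ambient A)).
Proof.
move=> cJ; set D : set (ambient A) := _ `*` _.
have constraint (g : ambient A -> R) (C : set R) : continuous g -> closed C ->
    (forall x, D x -> C (g x)) -> forall x, closure D x -> C (g x).
  move=> cg cC DC x Dx.
  have : closed (g @^-1` C) by apply: closed_comp => // y _; exact: cg.
  by apply; apply: closure_subset Dx.
have eq0 (g : ambient A -> R) : continuous g -> (forall x, D x -> g x = 0) ->
    forall x, closure D x -> g x = 0.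
  by move=> cg; apply: (constraint g [set 0]) => //; exact: closed1.
have c1 := continuous_coord1.
have cB (g h : ambient A -> R) : continuous g -> continuous h ->
    continuous (fun x => g x - h x) by move=> cg ch y; exact: (cvgB (cg y) (ch y)).
have cD (g h : ambient A -> R) : continuous g -> continuous h ->
    continuous (fun x => g x + h x) by move=> cg ch y; exact: (cvgD (cg y) (ch y)).
have cM (g h : ambient A -> R) : continuous g -> continuous h ->
    continuous (fun x => g x * h x) by move=> cg ch y; exact: (cvgM (cg y) (ch y)).
have cC (r : R) : continuous (fun _ : ambient A => r) by exact: cst_continuous.
move=> x Dx; split; last first.
  by apply: (constraint _ J continuous_coord2 cJ) Dx => y [].
split.
- move=> c a b; apply/eqP; rewrite -subr_eq0; apply/eqP.
  pose g := fun x : ambient A => x.1 (c *: a + b) - (c * x.1 a + x.1 b).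
  have cg : continuous g by exact: cB (c1 _) (cD _ _ (cM _ _ (cC c) (c1 a)) (c1 b)).
  by apply: (eq0 g cg) Dx => y [[lin _ _] _]; rewrite /g lin subrr.
- split=> [|a b]; apply/eqP; rewrite -subr_eq0; apply/eqP.
    pose g := fun x : ambient A => x.1 1 - 1.
    have cg : continuous g by exact: cB (c1 1) (cC 1).
    by apply: (eq0 g cg) Dx => y [[_ [g1 _] _] _]; rewrite /g g1 subrr.
  pose g := fun x : ambient A => x.1 (a * b) - (x.1 a * x.1 b).
  have cg : continuous g by exact: cB (c1 _) (cM _ _ (c1 a) (c1 b)).
  by apply: (eq0 g cg) Dx => y [[_ [_ gM] _] _]; rewrite /g gM subrr.
- move=> b Sb.
  have cge : closed [set r : R | 0 <= r] by exact: closed_ge.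
  by apply: (constraint _ _ (@c1 b) cge) Dx => y [[_ _ pos] _]; exact: pos.
Qed.
End Ambient.

(** * Binary coding of points by thresholds *)

Section Thresholds.
Variables (R : realType) (T : Type) (I : countType) (coord : I -> T -> R).

(** The [k]-th bit of a point compares the [i]-th coordinate with the rational
    [q], where [k] encodes the pair [(i, q)]. *)
Definition threshold_bit (k : nat) (x : T) : bool :=
  if unpickle k is Some (i, q) then coord i x < ratr (q : rat) else false.

Let same_bits n x y :=
  forall k, (k < n)%N -> threshold_bit k x = threshold_bit k y.

Lemma same_bits_threshold i (q : rat) : exists n, forall x y, same_bits n x y ->
  (coord i x < ratr q) = (coord i y < ratr q).
Proof.
exists (pickle (i, q)).+1 => x y /(_ (pickle (i, q)) (ltnSn _)).
by rewrite /threshold_bit pickleK.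
Qed.

Lemma same_bits_grid i (f : nat -> rat) N : exists n, forall x y, same_bits n x y ->
  forall j, (j < N)%N -> (coord i x < ratr (f j)) = (coord i y < ratr (f j)).
Proof.
elim: N => [|N [n Hn]]; first by exists 0%N.
have [m Hm] := same_bits_threshold i (f N).
exists (maxn n m) => x y xy j; rewrite ltnS leq_eqVlt => /orP[/eqP ->|].
  by apply: Hm => k km; apply: xy; rewrite leq_max km orbT.
by apply: Hn => k kn; apply: xy; rewrite leq_max kn.
Qed.

(** The thresholds are a grid of mesh [1 / M] on the segment from [- K] to [K],
    and the value at [x] lies between two successive ones. *)
Lemma same_bits_near i (C e : R) : 0 < e -> exists n, forall x y, same_bits n x y ->
  `|coord i x| <= C -> `|coord i x - coord i y| <= e.
Proof.
move=> e0.
pose M := (Num.bound e^-1).+1; pose K := (Num.bound `|C|).+1.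
have M0 : 0 < M%:R :> R by rewrite ltr0n.
have Me : M%:R^-1 <= e.
  rewrite -[leRHS]invrK lef_pV2 ?posrE ?invr_gt0//.
  apply: le_trans (ltW (archi_boundP _)) _; last by rewrite ler_nat.
  by rewrite invr_ge0 ltW.
have CK : C <= K%:R.
  apply: le_trans (ler_norm C) _; apply: le_trans (ltW (archi_boundP _)) _ => //.
  by rewrite ler_nat.
pose f j : rat := j%:R / M%:R - K%:R.
have fE j : ratr (f j) = j%:R / M%:R - K%:R :> R.
  by rewrite rmorphB/= fmorph_div/= !ratr_nat.
have [n Hn] := same_bits_grid i f (2 * K * M + M).+1.
exists n => x y /Hn xy; rewrite ler_norml => /andP[C1 C2].
have exj : exists j, coord i x < ratr (f j).
  exists (2 * K * M + M)%N; rewrite fE natrD !natrM mulrDl mulfK ?gt_eqF//.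
  by rewrite divff ?gt_eqF// (le_lt_trans C2)// (le_lt_trans CK)//; lra.
have jP := ex_minnP exj; case: jP => j xj jmin.
have jN : (j <= 2 * K * M + M)%N.
  apply: jmin; rewrite fE natrD !natrM mulrDl mulfK ?gt_eqF//.
  by rewrite divff ?gt_eqF// (le_lt_trans C2)// (le_lt_trans CK)//; lra.
case: j => [|j] in xj jmin jN *.
  by move: xj; rewrite fE mul0r sub0r => xj; lra.
have xj' : (coord i x < ratr (f j)) = false.
  by apply/negP => /jmin; rewrite ltnn.
have yj := xy j (leqW jN); have yj1 := xy j.+1 jN.
move: yj; rewrite xj' => /esym/negbT; rewrite -leNgt => yj.
move: yj1; rewrite xj => /esym yj1.
move/negbT: xj'; rewrite -leNgt => xj'.
have jE : j.+1%:R / M%:R = j%:R / M%:R + M%:R^-1 :> R.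
  by rewrite -[j.+1]addn1 natrD mulrDl mul1r.
apply: le_trans Me; rewrite !fE in xj xj' yj yj1; rewrite jE in xj yj1.
by rewrite ler_norml; apply/andP; split; lra.
Qed.
End Thresholds.

(** * The functional on functions of polynomial growth *)

Section Evaluation.
Variables (R : realType) (A : comAlgType R) (S : set A) (J : set R).
Let X : set (ambient A) := char S `*` J.
Implicit Types (x : ambient A) (f g : {poly A}).

Lemma evalD f g x : X x -> eval (f + g) x = eval f x + eval g x.
Proof. by move=> [cx _]; rewrite /eval hornerD (charD cx). Qed.

Lemma evalM f g x : X x -> eval (f * g) x = eval f x * eval g x.
Proof. by move=> [cx _]; rewrite /eval hornerM (charM cx). Qed.

Lemma evalC a x : eval a%:P x = x.1 a.
Proof. by rewrite /eval hornerC. Qed.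

Lemma evalX x : X x -> eval 'X x = x.2.
Proof. by move=> [cx _]; rewrite /eval hornerX (charC cx). Qed.

Lemma evalZ (c : R) f x : X x -> eval (c%:A *: f) x = c * eval f x.
Proof. by move=> Xx; rewrite -mul_polyC evalM// evalC (charC Xx.1). Qed.

(** Off [X] the function [x.1] need not be additive, and [eval f] need not be
    continuous; this extends the restriction of [eval f] to [X]. *)
Definition continuous_eval f x : R := \sum_(i < size f) x.2 ^+ i * x.1 f`_i.

Lemma continuous_evalE f x : X x -> continuous_eval f x = eval f x.
Proof.
move=> [cx _]; rewrite [x]surjective_pairing (eval_char _ _ cx).
by apply: eq_bigr => i _; rewrite mulrC.
Qed.

Lemma continuous_eval_continuous f : continuous (continuous_eval f : ambient A -> R).
Proof.
have cX i : continuous (fun x : ambient A => x.2 ^+ i : R).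
  elim: i => [|i IH]; first exact: cst_continuous.
  move=> x; rewrite (_ : (fun _ => _) = (fun x : ambient A => x.2 * x.2 ^+ i)).
    exact: (cvgM (@continuous_coord2 _ _ x) (IH x)).
  by apply/funext => z; rewrite exprS.
have cF i : continuous (fun x : ambient A => x.2 ^+ i * x.1 f`_i : R).
  by move=> x; exact: (cvgM (cX i x) (@continuous_coord1 _ _ f`_i x)).
have gen (s : seq 'I_(size f)) :
    continuous (fun x : ambient A => \sum_(i <- s) x.2 ^+ i * x.1 f`_i : R).
  elim: s => [|i s IH] x.
    rewrite (_ : (fun _ => _) = (fun=> 0)); first exact: cst_continuous.
    by apply/funext => z; rewrite big_nil.
  rewrite (_ : (fun _ => _) = (fun x : ambient A => x.2 ^+ i * x.1 f`_i +
      \sum_(i <- s) x.2 ^+ i * x.1 f`_i)).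
    exact: (cvgD (cF i x) (IH x)).
  by apply/funext => z; rewrite big_cons.
exact: gen.
Qed.
End Evaluation.

Section Extension.
Variables (R : realType) (A : comAlgType R) (S : set A) (J : set R).
Variable L : {poly A} -> R.
Hypotheses (semiringS : is_semiring S) (archS : archimedean S).
Hypothesis fgA : finitely_generated A.
Hypothesis linL : real_linear L.
Hypothesis posL : forall f, tensor_Pos S J f -> 0 <= L f.

Let X : set (ambient A) := char S `*` J.

Definition poly_dominated (u : ambient A -> R) : Prop :=
  exists h : {poly A}, forall x, X x -> `|u x| <= eval h x.

(** By [functional_ge0] the functional [L] is positive on the restrictions to [X]
    of the functions [eval f]. *)
Lemma functional_extension : exists F : (ambient A -> R) -> R,
  [/\ forall f, F (eval f) = L f,
      forall c u v, poly_dominated u -> poly_dominated v ->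
        F (fun x => c * u x + v x) = c * F u + F v &
      forall u, poly_dominated u -> (forall x, X x -> 0 <= u x) -> 0 <= F u].
Proof.
pose G : set ((ambient A -> R) * R) :=
  [set p | exists f, p.2 = L f /\ forall x, X x -> p.1 x = eval f x].
have G0 : G ((fun=> 0), 0).
  exists 0; split => [|x [cx _]]; first by rewrite (functional0 linL).
  by rewrite /eval horner0 (char0 cx).
have linG : linear_graph G.
  move=> c u r v s [f [/= -> fu]] [g [/= -> gv]]; exists (c%:A *: f + g).
  by split=> [|x Xx] /=; rewrite ?linL// (evalD _ _ Xx) (evalZ _ _ Xx) fu ?gv.
have posG : positive_graph X G.
  move=> u r [f [/= -> fu]] u0; apply: (functional_ge0 semiringS archS fgA linL posL).
  by move=> phi t cphi Jt; rewrite -(fu (phi, t)) ?u0.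
have [F [F1 F2 F3]] := positive_extension G0 linG posG.
have dom u : poly_dominated u -> dominated X G u.
  by move=> [h hP]; exists (eval h), (L h); split => //; exists h.
exists F; split.
- by move=> f; apply: F1; exists f.
- by move=> c u v /dom du /dom dv; exact: F2.
- by move=> u /dom; exact: F3.
Qed.
End Extension.

(** * Images of Lebesgue measure *)

Section BorelImage.
Variables (R : realType) (T : ptopologicalType).

Lemma open_borel (U : set T) : open U -> measurable (U : set (borel T)).
Proof. exact: sub_sigma_algebra. Qed.

Lemma closed_borel (C : set T) : closed C -> measurable (C : set (borel T)).
Proof.
move=> cC; have oC : open (~` C) by rewrite openC.
by rewrite -(setCK C); apply: measurableC; exact: open_borel.
Qed.

Lemma continuous_borel (f : T -> R) : continuous f ->
  measurable_fun [set: borel T] (f : borel T -> R).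
Proof.
move=> /continuousP cf; apply: (measurability _ (RGenOInfty.measurableE R)).
move=> _ [_ [a ->] <-]; rewrite setTI; apply: open_borel; apply: cf.
by apply: interval_open.
Qed.

(** Off a countable set, which is null, [Phi] is continuous on [Omega]; it maps
    the compact sets that approximate a preimage from inside to compact sets. *)
Theorem radon_image (Omega E : set R) (mOmega : measurable Omega)
    (Phi : R -> borel T) (mPhi : measurable_fun [set: R] Phi)
    (mu : {measure set (borel T) -> \bar R}) :
  hausdorff_space T -> (lebesgue_measure Omega < +oo)%E -> countable E ->
  (forall t, Omega t -> ~ E t -> (Phi : R -> T) @ t --> (Phi t : T)) ->
  (forall B, mu B = lebesgue_measure (Phi @^-1` B `&` Omega)) ->
  radon mu.
Proof.
move=> hT finO cE cPhi imageE.
have mPre (B : set (borel T)) : measurable B -> measurable (Phi @^-1` B).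
  by move=> mB; rewrite -[X in measurable X]setTI; exact: mPhi.
have mE : measurable E by exact: countable_measurable.
have E0 : lebesgue_measure E = 0%E by exact: countable_lebesgue_measure0.
split=> [K cK mK|B mB].
  rewrite imageE (le_lt_trans _ finO)//.
  by apply: le_measure; rewrite ?inE//; apply: measurableI => //; exact: mPre.
have mBO : measurable (Phi @^-1` B `&` Omega) by apply: measurableI => //; exact: mPre.
apply/eqP; rewrite eq_le; apply/andP; split; last first.
  apply: ge_ereal_sup => _ [K [cK mK KB] <-]; rewrite !imageE.
  apply: le_measure; rewrite ?inE//; first by apply: measurableI => //; exact: mPre.
  by apply: setSI; exact: preimage_subset.
apply/lee_addgt0Pr => e e0.
set M := (Phi @^-1` B `&` Omega) `\` E.
have mM : measurable M by exact: measurableD.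
have finM : (lebesgue_measure M < +oo)%E.
  by apply: le_lt_trans finO; apply: le_measure; rewrite ?inE// => t [[]].
have [V [cV VM MV]] := lebesgue_regularity_inner mM finM e0.
have cK : compact ((Phi : R -> T) @` V).
  apply: continuous_compact cV; apply: continuous_in_subspaceT => t /set_mem /VM.
  by move=> [[_ Ot] Et]; exact: cPhi.
have mK : measurable ((Phi @` V : set T) : set (borel T)).
  by apply: closed_borel; exact: compact_closed.
have mV : measurable V by exact: compact_measurable.
have lebM : lebesgue_measure (Phi @^-1` B `&` Omega) = lebesgue_measure M.
  rewrite (measureDI lebesgue_measure mBO mE) -/M -[RHS]adde0; congr (_ + _)%E.
  apply/eqP; rewrite -measure_le0 -E0; apply: le_measure; rewrite ?inE//.
  exact: measurableI.
rewrite imageE lebM (measureDI lebesgue_measure mM mV) setIidr// addeC leeD//; last exact: ltW.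
apply: (@le_trans _ _ (lebesgue_measure (Phi @^-1` (Phi @` V) `&` Omega))).
  apply: le_measure; rewrite ?inE//; first by apply: measurableI => //; exact: mPre.
  by move=> t Vt; split; [exists t|have [[]] := VM _ Vt].
rewrite -imageE; apply: ereal_sup_ubound; exists (Phi @` V) => //; split => //.
by move=> _ [t Vt <-]; have [[]] := VM _ Vt.
Qed.

Lemma measure_image (Omega : set R) (mOmega : measurable Omega)
    (Phi : R -> borel T) (mPhi : measurable_fun [set: R] Phi) :
  exists mu : {measure set (borel T) -> \bar R},
    mu = pushforward (mrestr lebesgue_measure mOmega) Phi :> (_ -> _).
Proof.
unshelve eexists (pushforward (mrestr lebesgue_measure mOmega) Phi).
  exact: mPhi.
by [].
Qed.
End BorelImage.

(** * The representing measure *)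

Section Representation.
Variables (R : realType) (A : comAlgType R) (S : set A) (J : set R).
Variable L : {poly A} -> R.
Hypotheses (semiringS : is_semiring S) (archS : archimedean S).
Hypothesis closedJ : closed J.

Let X : set (ambient A) := char S `*` J.

Variable F : (ambient A -> R) -> R.
Hypothesis linL : real_linear L.
Hypothesis F_eval : forall f, F (eval f) = L f.
Hypothesis F_linear : forall c u v, poly_dominated S J u -> poly_dominated S J v ->
  F (fun x => c * u x + v x) = c * F u + F v.
Hypothesis F_ge0 : forall u, poly_dominated S J u ->
  (forall x, X x -> 0 <= u x) -> 0 <= F u.

Variables (d : nat) (y : 'I_d -> A).
Hypothesis Sy : forall i, S (y i) /\ S (1 - y i).
Hypothesis y_gen : forall Q : A -> Prop, (forall i, Q (y i)) -> Q 1 ->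
  (forall (c : R) a b, Q a -> Q b -> Q (c *: a + b)) ->
  (forall a b, Q a -> Q b -> Q (a * b)) -> forall a, Q a.

Definition coordinate (o : option 'I_d) (x : ambient A) : R :=
  if o is Some i then x.1 (y i) else x.2.

Let beta := threshold_bit coordinate.
Let bnd := @bounded_on R _ X.
Let res := @resolved R _ X beta.

Let bnd_dominated u : bnd u -> poly_dominated S J u.
Proof.
move=> [C uC]; exists C%:A%:P => x Xx; rewrite evalC (charC Xx.1).
exact: uC.
Qed.

Let Fb_linear c u v : bnd u -> bnd v -> F (fun x => c * u x + v x) = c * F u + F v.
Proof. by move=> bu bv; apply: F_linear; exact: bnd_dominated. Qed.

Let Fb_ge0 u : bnd u -> (forall x, X x -> 0 <= u x) -> 0 <= F u.
Proof. by move=> /bnd_dominated; exact: F_ge0. Qed.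

(** * Resolved functions *)

Lemma bounded_character a : bnd (fun x => x.1 a).
Proof.
have [C _ aC] := char_bounded archS a; exists C => x [cx _]; exact: aC.
Qed.

Lemma resolved_character a : res (fun x => x.1 a).
Proof.
move: a; apply: y_gen => [i||c a b ra rb|a b ra rb].
- move=> e e0; have [n Hn] := same_bits_near coordinate (Some i) 1 e0.
  exists n => x z [cx _] _ xz; apply: (Hn x z xz) => /=.
  have [S1 S2] := Sy i; rewrite ger0_norm; last exact: (char_ge0 cx S1).
  by rewrite -subr_ge0 -(char1 cx) -(charB cx); exact: (char_ge0 cx S2).
- by apply: resolved_eq (resolved_cst _ _ 1) => x [cx _]; rewrite (char1 cx).
- have : res (fun x => c * x.1 a + x.1 b).
    apply: resolvedD => //; apply: resolvedM => //; [|exact: bounded_character|].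
      exact: bounded_on_cst.
    exact: resolved_cst.
  by apply: resolved_eq => x [cx _]; rewrite (charD cx) (charZ cx).
- have : res (fun x => x.1 a * x.1 b).
    by apply: resolvedM => //; exact: bounded_character.
  by apply: resolved_eq => x [cx _]; rewrite (charM cx).
Qed.

Definition slab (N : nat) : set (ambient A) := [set x | - N%:R <= x.2 < N%:R].

Lemma slab_le N M : (N <= M)%N -> slab N `<=` slab M.
Proof.
move=> NM x /andP[x1 x2]; have : (N%:R : R) <= M%:R by rewrite ler_nat.
by rewrite /slab/=; lra.
Qed.

Lemma slab_bits N : exists n, forall x z,
  (forall k, (k < n)%N -> beta k x = beta k z) -> slab N x = slab N z.
Proof.
have [n Hn] := same_bits_threshold coordinate None (N%:R).
have [m Hm] := same_bits_threshold coordinate None (- N%:R).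
exists (maxn n m) => x z xz.
have := Hn x z (fun k kn => xz k (leq_trans kn (leq_maxl _ _))).
have := Hm x z (fun k km => xz k (leq_trans km (leq_maxr _ _))).
by rewrite /= rmorphN/= !ratr_nat /slab/= !(leNgt (- _)) => -> ->.
Qed.

Lemma resolved_slab N : res \1_(slab N).
Proof.
have [n Hn] := slab_bits N => e e0; exists n => x z _ _ xz.
rewrite !indicE (_ : (x \in slab N) = (z \in slab N)) ?subrr ?normr0 ?ltW//.
by apply/idP/idP => /set_mem; [rewrite (Hn _ _ xz)|rewrite -(Hn _ _ xz)] => /mem_set.
Qed.

Lemma bounded_slab_coord N : bnd (fun x => x.2 * \1_(slab N) x).
Proof.
exists N%:R => x _; rewrite indicE; have [xN|xN] := pselect (slab N x).
  rewrite mem_set// mulr1 ler_norml; case/andP: xN => -> x2; exact: ltW.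
by rewrite memNset// mulr0 normr0.
Qed.

Lemma resolved_slab_coord N : res (fun x => x.2 * \1_(slab N) x).
Proof.
have [m Hm] := slab_bits N => e e0.
have [n Hn] := same_bits_near coordinate None N%:R e0.
exists (maxn n m) => x z _ _ xz.
have slabE := Hm x z (fun k km => xz k (leq_trans km (leq_maxr _ _))).
rewrite !indicE; have [xN|xN] := pselect (slab N x); last first.
  rewrite (memNset xN) memNset ?mulr0 ?subrr ?normr0 ?ltW//.
  by rewrite -slabE.
rewrite (mem_set xN) mem_set ?mulr1; last by rewrite -slabE.
apply: (Hn x z (fun k kn => xz k (leq_trans kn (leq_maxl _ _)))) => /=.
by rewrite ler_norml; case/andP: xN => -> x2; exact: ltW.
Qed.

(** By induction on [f], as [f X + a] is, on the slab, the product of [f] and [z]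
    plus [a], and all three are bounded and resolved there. *)
Lemma slab_eval f N : bnd (fun x => eval f x * \1_(slab N) x) /\
  res (fun x => eval f x * \1_(slab N) x).
Proof.
elim/poly_ind: f => [|f a [bf rf]].
  have e0 x : X x -> 0 = eval (0 : {poly A}) x * \1_(slab N) x.
    by move=> [cx _]; rewrite /eval horner0 (char0 cx) mul0r.
  split; last by apply: resolved_eq e0 (resolved_cst _ _ 0).
  by exists 0 => x Xx; rewrite -e0 ?normr0.
have e x : X x -> (eval f x * \1_(slab N) x) * (x.2 * \1_(slab N) x) +
    x.1 a * \1_(slab N) x = eval (f * 'X + a%:P) x * \1_(slab N) x.
  move=> Xx; rewrite (evalD _ _ Xx) (evalM _ _ Xx) evalC (evalX Xx).
  by rewrite indicE; case: (x \in slab N) => /=; ring.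
have ba : bnd (fun x => x.1 a * \1_(slab N) x).
  by apply: bounded_onM; [exact: bounded_character|exact: bounded_on_indic].
have bfz : bnd (fun x => (eval f x * \1_(slab N) x) * (x.2 * \1_(slab N) x)).
  by apply: bounded_onM => //; exact: bounded_slab_coord.
split.
  have [C HC] : bnd (fun x => (eval f x * \1_(slab N) x) * (x.2 * \1_(slab N) x) +
    x.1 a * \1_(slab N) x) by exact: bounded_onD.
  by exists C => x Xx; rewrite -e ?HC.
apply: resolved_eq e _; apply: resolvedD.
  apply: resolvedM => //; [exact: bounded_slab_coord|exact: resolved_slab_coord].
apply: resolvedM; [exact: bounded_character|exact: bounded_on_indic| |].
  exact: resolved_character.
exact: resolved_slab.
Qed.

(** * Tails *)

(** If [h] dominates [f], then [h (1 + z ^ 2) + C] dominates [f z + a], where [C]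
    bounds [a] on the characters. *)
Lemma eval_dominated f : exists h : {poly A}, forall x, X x -> `|eval f x| <= eval h x.
Proof.
elim/poly_ind: f => [|f a [h hP]].
  by exists 0 => x [cx _]; rewrite /eval horner0 (char0 cx) normr0.
have [C aC] := bounded_character a.
exists (h * (1%:P + 'X * 'X) + C%:A%:P) => x Xx.
rewrite !(evalD _ _ Xx) !(evalM _ _ Xx) (evalD _ _ Xx) (evalM _ _ Xx) !evalC.
rewrite (evalX Xx) (charC Xx.1) (char1 Xx.1).
rewrite (le_trans (ler_normD _ _))// lerD ?aC// normrM ler_pM ?hP//.
have := sqr_ge0 (`|x.2| - 1); have : `|x.2| ^+ 2 = x.2 * x.2.
  by rewrite real_normK ?num_real ?expr2.
by have := sqr_ge0 (x.2); nra.
Qed.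

Lemma poly_dominated_eval f : poly_dominated S J (eval f).
Proof. by have [h hP] := eval_dominated f; exists h. Qed.

Lemma poly_dominated_linear c u v : poly_dominated S J u -> poly_dominated S J v ->
  poly_dominated S J (fun x => c * u x + v x).
Proof.
move=> [g ug] [h vh]; exists (`|c|%:A *: g + h) => x Xx.
rewrite (evalD _ _ Xx) (evalZ _ _ Xx) (le_trans (ler_normD _ _))// lerD ?vh//.
by rewrite normrM ler_wpM2l// ug.
Qed.

Lemma F_norm_le u v : poly_dominated S J u -> poly_dominated S J v ->
  (forall x, X x -> `|u x| <= v x) -> `|F u| <= F v.
Proof.
move=> du dv uv.
have h1 : 0 <= 1 * F u + F v.
  rewrite -F_linear//; apply: F_ge0; first exact: poly_dominated_linear.
  by move=> x /uv; rewrite ler_norml mul1r; lra.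
have h2 : 0 <= -1 * F u + F v.
  rewrite -F_linear//; apply: F_ge0; first exact: poly_dominated_linear.
  by move=> x /uv; rewrite ler_norml mulN1r; lra.
by rewrite ler_norml; apply/andP; split; lra.
Qed.

(** Outside of the slab of height [N], [|f|] is at most [h z ^ 2 / N] for some
    polynomial [h]. *)
Lemma slab_eval_cvg f : F (fun x => eval f x * \1_(slab N.+1) x) @[N --> \oo] --> L f.
Proof.
have [h hP] := eval_dominated f.
have Xh x : X x -> 0 <= eval h x by move=> /hP; exact: le_trans.
pose g := h * ('X * 'X); have L0 : 0 <= L g.
  rewrite -F_eval; apply: F_ge0 (poly_dominated_eval g) _ => x Xx.
  rewrite (evalM _ _ Xx) (evalM _ _ Xx) (evalX Xx) mulr_ge0 ?Xh//.
  by rewrite -expr2 sqr_ge0.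
have tail (N : nat) x : X x -> `|-1 * (eval f x * \1_(slab N.+1) x) + eval f x| <=
    eval ((N.+1%:R^-1)%:A *: g) x.
  move=> Xx; rewrite (evalZ _ _ Xx) !(evalM _ _ Xx) (evalX Xx) indicE.
  have [xN|xN] := pselect (slab N.+1 x).
    rewrite mem_set// mulr1 mulN1r addNr normr0 mulr_ge0 ?invr_ge0//.
    by rewrite mulr_ge0 ?Xh// -expr2 sqr_ge0.
  rewrite memNset// !mulr0 add0r mulrCA (le_trans (hP _ Xx))// ler_peMr ?Xh//.
  rewrite mulrC ler_pdivlMr ?ltr0n// mul1r.
  have N1 : 1 <= N.+1%:R :> R by rewrite ler1n.
  have : ~~ (- N.+1%:R <= x.2 < N.+1%:R) by apply/negP.
  by rewrite negb_and -ltNge -leNgt => /orP[?|?]; nra.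
have slabdom (N : nat) : poly_dominated S J (fun x => eval f x * \1_(slab N) x).
  by apply: bnd_dominated; exact: (slab_eval f N).1.
have err (N : nat) : `|L f - F (fun x => eval f x * \1_(slab N.+1) x)| <= N.+1%:R^-1 * L g.
  rewrite -(functionalZ linL) -!F_eval addrC -mulN1r -F_linear//; last first.
    exact: poly_dominated_eval.
  apply: F_norm_le (tail N); last exact: poly_dominated_eval.
  by apply: poly_dominated_linear => //; exact: poly_dominated_eval.
apply/cvgrPdist_le => e e0.
have /cvgrPdist_le/(_ (e / (L g + 1))) : N.+1%:R^-1 @[N --> \oo] --> (0 : R).
  exact: cvg_harmonic.
have Lg1 : 0 < L g + 1 by rewrite ltr_wpDl.
rewrite divr_gt0// => /(_ isT)[M _ HM]; exists M => // N /HM /=.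
rewrite sub0r normrN ger0_norm ?invr_ge0// => le; apply: le_trans (err N) _.
rewrite (le_trans (ler_wpM2r L0 le))// mulrAC ler_pdivrMr// ler_pM2l//.
by rewrite lerDl.
Qed.
(** * The limit map *)

Let I0 := cell_itv X beta F [::].
Let lim_at := tree_lim X beta F.
Let smp := sample X beta F.

Definition limit_point (t : R) : ambient A :=
  ((fun a => lim_at (fun x => x.1 a) t), lim ((smp t n).2 @[n --> \oo])).

(** The parameters for which the limit point has its last coordinate under
    control; [in_slabs] collects those whose branch does not escape to infinity. *)
Definition in_slab (N : nat) : set R :=
  [set t | I0 t /\ \forall n \near \oo, slab N (smp t n)].

Definition in_slabs : set R := \bigcup_N in_slab N.

Let sample_cell n t : I0 t -> cell X beta (cell_code X beta F t n) (smp t n).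
Proof. exact: (cell_sample Fb_linear). Qed.

Let sample_X n t : I0 t -> X (smp t n).
Proof. by move=> /(sample_cell n)[]. Qed.

Lemma slab_cells N : exists n, forall c x z, (n <= size c)%N ->
  cell X beta c x -> cell X beta c z -> slab N x = slab N z.
Proof.
have [n Hn] := slab_bits N; exists n => c x z nc [_ cx] [_ cz]; apply: Hn => k kn.
have kc : (k < size c)%N by exact: leq_trans nc.
by rewrite -(nth_mkseq false (beta^~ x) kc) cx -cz nth_mkseq.
Qed.

(** The cells that are deep enough are inside or outside of the slab. *)
Lemma in_slab_cell N t : I0 t -> exists c,
  cell_itv X beta F c t /\ forall s, cell_itv X beta F c s ->
   forall n, (size c <= n)%N -> slab N (smp s n) = slab N (smp t (size c)).
Proof.
move=> t0; have [n Hn] := slab_cells N.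
have tc := itv_code Fb_linear n t0; exists (cell_code X beta F t n); split => // s cs m.
rewrite size_code => nm; apply: (Hn (cell_code X beta F t n)); rewrite ?size_code//.
  apply: (cell_code_itv Fb_linear Fb_ge0 (n := m) cs); first by rewrite size_code.
  by apply: sample_cell; exact: (itv_root Fb_linear Fb_ge0 cs).
exact: sample_cell.
Qed.

Lemma in_slabVnot N t : I0 t ->
  in_slab N t \/ \forall n \near \oo, ~ slab N (smp t n).
Proof.
move=> t0; have [c [ct cP]] := in_slab_cell N t0.
have [tN|tN] := pselect (slab N (smp t (size c))); [left; split=> //|right];
  by exists (size c) => // n /= cn; rewrite (cP t ct n cn).
Qed.

Lemma in_slab_tree_open N t : in_slab N t ->
  exists2 c, cell_itv X beta F c t & cell_itv X beta F c `<=` in_slab N.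
Proof.
move=> [t0 [n0 _ tN]]; have [c [ct cP]] := in_slab_cell N t0.
exists c => // s cs; split; first exact: (itv_root Fb_linear Fb_ge0 cs).
exists (size c) => // n /= cn; rewrite (cP s cs n cn).
by rewrite -(cP t ct (maxn n0 (size c)) (leq_maxr _ _)); apply: tN; exact: leq_maxl.
Qed.

Lemma in_slab_le N M : (N <= M)%N -> in_slab N `<=` in_slab M.
Proof.
move=> NM t [t0 [n _ tN]]; split=> //; exists n => // m nm.
by apply: (slab_le NM); exact: tN.
Qed.

(** The samples are eventually in the slab, where truncating has no effect. *)
Lemma truncated_cvg N u t : in_slab N t -> res (fun x => u x * \1_(slab N) x) ->
  u (smp t n) @[n --> \oo] --> lim_at (fun x => u x * \1_(slab N) x) t.
Proof.
move=> [t0 tN] ru.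
have := resolved_cvg Fb_linear ru t0; apply: cvg_trans.
apply: near_eq_cvg; apply: filterS tN => n tn.
by rewrite /= indicE mem_set// mulr1.
Qed.

Lemma limit_point2 N t : in_slab N t ->
  (limit_point t).2 = lim_at (fun x => x.2 * \1_(slab N) x) t.
Proof.
move=> tN; apply/cvg_lim => //; apply: truncated_cvg tN _.
exact: resolved_slab_coord.
Qed.

Lemma sample_cvg t : in_slabs t -> smp t n @[n --> \oo] --> limit_point t.
Proof.
move=> [N _ tN]; apply: ambient_cvg => [a|].
  exact: (resolved_cvg Fb_linear (resolved_character a) tN.1).
rewrite (limit_point2 tN); apply: truncated_cvg tN _.
exact: resolved_slab_coord.
Qed.

Lemma limit_point_X t : in_slabs t -> X (limit_point t).
Proof.
move=> tO; have [N _ [t0 _]] := tO.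
have near : \forall n \near \oo, X (smp t n) by apply: nearW => n; exact: sample_X.
have cX : closed X by exact: closed_char_setX.
exact: (@closed_cvg _ _ _ _ _ X cX near _ (sample_cvg tO)).
Qed.

Lemma truncated_lim N f t : I0 t ->
  lim_at (fun x => eval f x * \1_(slab N) x) t =
  eval f (limit_point t) * \1_(in_slab N) t.
Proof.
move=> t0; have [_ rf] := slab_eval f N.
have fcvg := resolved_cvg Fb_linear rf t0.
have [tN|tN] := in_slabVnot N t0; last first.
  rewrite indicE memNset ?mulr0; last first.
    move=> [_ tN']; have [n [/= n1 n2]] := filter_ex (filterI tN tN').
    exact: n1.
  apply: (cvg_unique _ fcvg) => //.
  apply: cvg_near_cst.
  by apply: filterS tN => n tn; rewrite /= indicE memNset// mulr0.
rewrite indicE mem_set// mulr1.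
apply: (cvg_unique _ (truncated_cvg tN rf)) => //.
have tO : in_slabs t by exists N.
rewrite -(continuous_evalE f (limit_point_X tO)).
have := cvg_comp _ _ (sample_cvg tO) (@continuous_eval_continuous _ _ f (limit_point t)).
apply: cvg_trans; apply: near_eq_cvg; apply: nearW => n /=.
by rewrite (continuous_evalE f (sample_X n t0)).
Qed.

(** * The integral representation on the line *)

Let leb := @lebesgue_measure R.
Let trunc (N : nat) f (x : ambient A) : R := eval f x * \1_(slab N.+1) x.

Lemma in_slabs_tree_open t : in_slabs t ->
  exists2 c, cell_itv X beta F c t & cell_itv X beta F c `<=` in_slabs.
Proof.
move=> [N _ tN]; have [c ct cN] := in_slab_tree_open tN; exists c => // s /cN sN.
by exists N.
Qed.

Lemma in_slabs_I0 : in_slabs `<=` I0.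
Proof. by move=> t [N _ []]. Qed.

Lemma measurable_in_slabs : measurable in_slabs.
Proof. by apply: measurable_tree_open => t; exact: in_slabs_tree_open. Qed.

Let measurable_I0 : measurable I0.
Proof. exact: measurable_itv_cell. Qed.

Let integral_trunc N f :
  (\int[leb]_(t in I0) (lim_at (trunc N f) t)%:E)%E = (F (trunc N f))%:E.
Proof.
have [bf rf] := slab_eval f N.+1.
rewrite -(tree_integral Fb_linear Fb_ge0 bf rf) /Rintegral fineK//.
apply: integrable_fin_num => //; exact: integrable_tree_lim.
Qed.

Let measurable_trunc N f : measurable_fun I0 (fun t => (lim_at (trunc N f) t)%:E).
Proof.
apply/measurable_EFinP; apply: (measurable_tree_lim Fb_linear Fb_ge0).
exact: (slab_eval f N.+1).2.
Qed.

Let trunc_cvg f t : I0 t -> (lim_at (trunc N f) t)%:E @[N --> \oo] -->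
  (eval f (limit_point t) * \1_in_slabs t)%:E.
Proof.
move=> t0; apply: cvg_near_cst.
have [[N0 _ tN0]|tO] := pselect (in_slabs t).
  exists N0 => // N /= N0N; rewrite truncated_lim// !indicE mem_set ?mem_set//.
    by exists N0.
  by apply: in_slab_le tN0; exact: leq_trans N0N (leqnSn N).
apply: nearW => N; rewrite truncated_lim// !indicE memNset ?memNset// => tN.
by apply: tO; exists N.+1.
Qed.

Let measurable_limit f :
  measurable_fun I0 (fun t => (eval f (limit_point t) * \1_in_slabs t)%:E).
Proof.
apply: (@emeasurable_fun_cvg _ _ _ _ (fun N t => (lim_at (trunc N f) t)%:E)).
  by move=> N; exact: measurable_trunc.
by move=> t; exact: trunc_cvg.
Qed.

Let integral_limit_ge0 h : (forall x, X x -> 0 <= eval h x) ->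
  (\int[leb]_(t in I0) (eval h (limit_point t) * \1_in_slabs t)%:E)%E = (L h)%:E.
Proof.
move=> h0; have hl0 N t : I0 t -> in_slab N t -> 0 <= eval h (limit_point t).
  by move=> t0 tN; apply/h0/limit_point_X; exists N.
have trunc0 N t : I0 t -> 0 <= lim_at (trunc N h) t.
  move=> t0; rewrite truncated_lim// indicE.
  have [tN|tN] := pselect (in_slab N.+1 t); last by rewrite memNset// mulr0.
  by rewrite mem_set// mulr1; exact: hl0 tN.
transitivity (\int[leb]_(t in I0) limn (fun N => (lim_at (trunc N h) t)%:E))%E.
  apply: eq_integral => t /set_mem t0; apply/esym/cvg_lim => //; exact: trunc_cvg.
rewrite monotone_convergence//.
- apply/cvg_lim => //; under eq_fun do rewrite integral_trunc.
  apply: cvg_EFin; first exact: nearW.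
  exact: slab_eval_cvg.
- by move=> N; exact: measurable_trunc.
- move=> t t0 N M NM; rewrite lee_fin !truncated_lim// !indicE.
  have [tN|tN] := pselect (in_slab N.+1 t); last first.
    rewrite (memNset tN) mulr0; have [tM|tM] := pselect (in_slab M.+1 t).
      by rewrite mem_set// mulr1; exact: hl0 tM.
    by rewrite memNset// mulr0.
  by rewrite !mem_set//; apply: in_slab_le tN; rewrite ltnS.
Qed.

(** The truncations of a dominating [h >= 0] increase to [h], so its integral is
    [L h] by monotone convergence; it then dominates the truncations of [f]. *)
Theorem limit_point_representation f :
  leb.-integrable in_slabs (fun t => (eval f (limit_point t))%:E) /\
  (\int[leb]_(t in in_slabs) (eval f (limit_point t))%:E)%E = (L f)%:E.
Proof.
have [h hP] := eval_dominated f.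
have h0 x : X x -> 0 <= eval h x by move=> /hP; exact: le_trans.
pose H t := (eval h (limit_point t) * \1_in_slabs t)%:E.
pose V t := (eval f (limit_point t) * \1_in_slabs t)%:E.
have intH : leb.-integrable I0 H.
  apply/integrableP; split; first exact: measurable_limit.
  rewrite (_ : (\int[leb]_(t in I0) `|H t|)%E = (L h)%:E) ?ltry//.
  rewrite -(integral_limit_ge0 h0); apply: eq_integral.
  move=> t /set_mem t0; rewrite gee0_abs// /H lee_fin indicE.
  have [tO|tO] := pselect (in_slabs t); last by rewrite memNset// mulr0.
  by rewrite mem_set// mulr1; apply/h0/limit_point_X.
have [] := @dominated_convergence _ _ _ leb I0 measurable_I0
  (fun N t => (lim_at (trunc N f) t)%:E) V H.
- by move=> N; exact: measurable_trunc.
- exact: measurable_limit.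
- by apply: aeW => t; exact: trunc_cvg.
- exact: intH.
- apply: aeW => t N t0; rewrite /H abse_EFin lee_fin truncated_lim// !indicE.
  have [tN|tN] := pselect (in_slab N.+1 t).
    have tO : in_slabs t by exists N.+1.
    by rewrite !mem_set// !mulr1; apply/hP/limit_point_X.
  rewrite (memNset tN) mulr0 normr0.
  have [tO|tO] := pselect (in_slabs t); last by rewrite memNset// mulr0.
  by rewrite mem_set// mulr1; apply/h0/limit_point_X.
move=> intV _ cvgV.
have VE : {in in_slabs, V =1 (fun t => (eval f (limit_point t))%:E)}.
  by move=> t tO; rewrite /V indicE tO mulr1.
have intL : (\int[leb]_(t in I0) V t)%E = (L f)%:E.
  apply: (cvg_unique _ cvgV) => //; rewrite /=.
  under eq_fun do rewrite integral_trunc.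
  apply: cvg_EFin; first exact: nearW.
  exact: slab_eval_cvg.
split.
  apply: (@eq_integrable _ _ _ leb _ measurable_in_slabs _ _ VE).
  apply: integrableS intV => //; [exact: measurable_in_slabs|exact: in_slabs_I0].
rewrite -intL -[in LHS](setIidr in_slabs_I0) integral_mkcondr.
apply: eq_integral => t _; rewrite patchE /V indicE.
by case: ifPn => _; rewrite ?mulr1 ?mulr0.
Qed.

(** * The image measure *)

(** The intervals of the tree around [t] generate a filter along which each
    coordinate of [limit_point] converges. *)
Lemma limit_point_tree_continuous t (U : set (ambient A)) :
  in_slabs t -> nbhs (limit_point t) U ->
  exists2 c, cell_itv X beta F c t &
    forall s, cell_itv X beta F c s -> in_slabs s /\ U (limit_point s).
Proof.
move=> tO nU; have t0 := in_slabs_I0 tO.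
pose FF : set_system R :=
  [set B | exists n, cell_itv X beta F (cell_code X beta F t n) `<=` B].
have filterFF : Filter FF.
  split.
  - by exists 0%N.
  - move=> B C [n Bn] [m Cm]; exists (maxn n m) => s ns.
    by split; [apply: Bn|apply: Cm];
      apply: (sub_itv_code Fb_linear Fb_ge0 _ ns); rewrite ?leq_maxl ?leq_maxr.
  - by move=> B C BC [n Bn]; exists n; exact: subset_trans BC.
have FFc c (B : set R) : cell_itv X beta F c t -> cell_itv X beta F c `<=` B -> FF B.
  by move=> ct cB; exists (size c); rewrite (code_itv Fb_linear Fb_ge0 ct).
have lim_cvg u : res u -> lim_at u s @[s --> FF] --> lim_at u t.
  move=> ru; apply/cvgrPdist_le => e e0.
  have [c ct cP] := tree_lim_tree_continuous Fb_linear Fb_ge0 ru t0 e0.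
  exact: FFc ct cP.
have FFU : FF (limit_point @^-1` U).
  have cvgt : limit_point @ FF --> limit_point t.
    apply: ambient_cvg => [a|]; first exact: (lim_cvg _ (resolved_character a)).
    have [N _ tN] := tO; rewrite (limit_point2 tN).
    apply: cvg_trans (lim_cvg _ (resolved_slab_coord N)).
    apply: near_eq_cvg; have [c ct cN] := in_slab_tree_open tN.
    by apply: FFc ct _ => s /cN sN; rewrite (limit_point2 sN).
  exact: cvgt.
have FFO : FF in_slabs by have [c ct cO] := in_slabs_tree_open tO; exact: FFc ct cO.
have [n nP] := filterI FFO FFU; exists (cell_code X beta F t n) => //.
exact: itv_code.
Qed.

(** Off the left end points of the intervals, the intervals of the tree around
    a point are neighborhoods. *)
Lemma nbhs_itv c t : cell_itv X beta F c t -> t <> left_end X beta F c ->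
  nbhs t (cell_itv X beta F c).
Proof.
move=> /itvP /andP[ct tc] nt.
have lt : left_end X beta F c < t by rewrite lt_neqAle ct andbT eq_sym; exact/eqP.
apply: filterS (near_in_itvoo (_ : t \in `]left_end X beta F c, left_end X beta F c + mass X beta F c[)).
  by move=> s; rewrite !in_itv/= => /andP[s1 s2]; apply/itvP; rewrite ltW.
by rewrite in_itv/= lt.
Qed.

(** This is not in [X], as characters are [1] at [1].  As the default value of
    [image_point] it makes [in_slabs] the exact preimage of [X]. *)
Definition off_char : ambient A := ((fun=> 0), 0).

Lemma off_charP : ~ X off_char.
Proof.
by move=> [cx _]; have := char1 cx; move/eqP; rewrite /off_char/= eq_sym oner_eq0.
Qed.

Definition image_point (t : R) : borel (ambient A) :=
  if `[< in_slabs t >] then limit_point t else off_char.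

Lemma image_pointE t : in_slabs t -> image_point t = limit_point t.
Proof. by move=> tO; rewrite /image_point asboolT. Qed.

Lemma measurable_image_point : measurable_fun [set: R] image_point.
Proof.
apply: (@measurability _ _ _ _ setT image_point (@open (ambient A)) erefl).
move=> _ [U oU <-]; rewrite setTI.
have mO : measurable (in_slabs `&` limit_point @^-1` U).
  apply: (measurable_tree_open (X := X) (beta := beta) (F := F)) => t [tO tU].
  have [|c ct cP] := limit_point_tree_continuous tO (U := U); last by exists c.
  exact: open_nbhs_nbhs.
have -> : image_point @^-1` U =
    (in_slabs `&` limit_point @^-1` U) `|` (~` in_slabs `&` [set _ | U off_char]).
  apply/seteqP; split=> t; rewrite /image_point/=; case: asboolP => tO.
  - by left.
  - by right.
  - by case=> [[]|[]].
  - by case=> [[]|[]].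
apply: measurableU => //; apply: measurableI.
  by apply: measurableC; exact: measurable_in_slabs.
have [Uo|Uo] := pselect (U off_char).
  by rewrite (_ : [set _ | _] = setT)//; apply/seteqP; split.
by rewrite (_ : [set _ | _] = set0)//; apply/seteqP; split.
Qed.

Lemma image_point_continuous t : in_slabs t ->
  ~ range (left_end X beta F) t ->
  (image_point : R -> ambient A) @ t --> (image_point t : ambient A).
Proof.
move=> tO tE U; rewrite (image_pointE tO) => nU.
have [c ct cP] := limit_point_tree_continuous tO nU.
apply: filterS (nbhs_itv ct _) => [s /cP[sO sU]|te]; last by apply: tE; exists c.
by rewrite /preimage/= image_pointE.
Qed.

(** The measure is the image of Lebesgue measure on [in_slabs] under
    [limit_point]. *)
Theorem representing_measure : moment_functional S J L.
Proof.
have [mu muE] := measure_image measurable_in_slabs measurable_image_point.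
have mX : measurable (X : set (borel (ambient A))).
  by apply: closed_borel; exact: closed_char_setX.
have preX : image_point @^-1` X = in_slabs.
  apply/seteqP; split=> t; rewrite /image_point/=; case: asboolP => // tO.
    by move=> /off_charP.
  by move=> _; exact: limit_point_X.
have muB B : mu B = leb (image_point @^-1` B `&` in_slabs) by rewrite muE.
have mip : measurable_fun [set: measurableTypeR R] image_point.
  exact: measurable_image_point.
exists mu; split.
- apply: (radon_image measurable_in_slabs measurable_image_point
    (E := range (left_end X beta F))) => //.
  + exact: ambient_hausdorff.
  + apply: le_lt_trans (ltry (mass X beta F [::])).
    rewrite -(lebesgue_itv beta Fb_ge0); apply: le_measure; rewrite ?inE//.
      exact: measurable_in_slabs.
    exact: in_slabs_I0.
  + by apply: sub_countable (card_image_le _ _) _; exact: countableP.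
  + exact: image_point_continuous.
- by rewrite muB -preimage_setC preX setICl; exact: measure0.
- move=> f ev.
  pose g (x : borel (ambient A)) := (continuous_eval f x)%:E.
  have gE : {in X, g =1 ev}.
    by move=> x /set_mem Xx; rewrite /g (continuous_evalE f Xx).
  have mg : measurable_fun [set: borel (ambient A)] g.
    apply/measurable_EFinP; apply: continuous_borel.
    exact: continuous_eval_continuous.
  have [intf intfL] := limit_point_representation f.
  have gimage : {in in_slabs, (fun t => (eval f (limit_point t))%:E) =1 g \o image_point}.
    move=> t /set_mem tO; rewrite /g/= (image_pointE tO).
    by rewrite (continuous_evalE f (limit_point_X tO)).
  have restrE (u : R -> \bar R) :
      (\int[mrestr leb measurable_in_slabs]_(t in in_slabs) u t =
       \int[leb]_(t in in_slabs) u t)%E.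
    apply: eq_measure_integral => B mB BO. by rewrite -[LHS]/(leb (B `&` in_slabs)) setIidl.
  have intg : (mrestr leb measurable_in_slabs).-integrable
      (image_point @^-1` X) (g \o image_point).
    rewrite preX; apply/integrableP; split.
      apply: measurable_funTS; exact: measurableT_comp mg measurable_image_point.
    rewrite restrE; have /integrableP[_] := intf; apply: le_lt_trans.
    rewrite le_eqVlt; apply/orP; left; apply/eqP; apply: eq_integral => t tO.
    by rewrite -gimage.
  have muX : mu.-integrable X g.
    by rewrite muE; exact: (integrable_pushforward mip mg intg mX).
  split; first exact: (@eq_integrable _ _ _ mu _ mX _ _ gE muX).
  transitivity (\int[mu]_(x in X) g x)%E; last exact: eq_integral.
  rewrite muE (integral_pushforward mip mg intg mX) preX restrE -intfL.
  exact: eq_integral.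
Qed.
End Representation.

Theorem corollary11p3 (R : realType) (A : comAlgType R) (S : set A)
    (J : set R) (L : {poly A} -> R)
    (fgA : finitely_generated A)
    (semiringS : is_semiring S)
    (archS : archimedean S)
    (unboundedJ : ~ bounded_set J)
    (closedJ : closed J)
    (linL : real_linear L)
    (posL : forall f, tensor_Pos S J f -> 0 <= L f) :
  moment_functional S J L.
Proof.
have [F [F_eval F_linear F_ge0]] :=
  functional_extension semiringS archS fgA linL posL.
have [d [y [Sy y_gen]]] := unit_interval_generators semiringS archS fgA.
exact: (representing_measure archS closedJ linL F_eval F_linear F_ge0 Sy y_gen).
Qed.
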